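(* Fix $0<p<\tfrac12$, let $q=1-p$ and $m_p=\lfloor 1/\log_2(1/q)\rfloor$. Let $H_1,\dots,H_r$ ($r\ge1$) be distinct canonical cube subgraphs, each with at most $m_p$ vertices. For each $j$ let $Y_j$ be the number of components of $Q_p=Q_p^d$ ambient-isomorphic to $H_j$, with mean $\lambda_j$, and let $t^*=\min_j v(H_j)$. Then as $d\to\infty$, $$d_{TV}\Big(\mathcal{L}(Y_1,\dots,Y_r),\ \prod_{j=1}^r\mathrm{Po}(\lambda_j)\Big)=O(d^{t^*+1}q^{t^*d}).$$
   Context: $Q^d$ is the hypercube on $\{0,1\}^d$; $Q_p^d$ is its random spanning subgraph keeping each edge independently with probability $p$. For a connected subgraph $H$ of $Q^d$, its support $S(H)$ is the set of indices $i$ with some edge $xy$ of $H$ having $x_i=0,y_i=1$, and $\mathrm{span}(H)=|S(H)|$. Its canonical copy is $Q^0$ if $H$ is a single vertex; otherwise, with $s=\mathrm{span}(H)$ and $\phi:[s]\to[d]$ the increasing injection with image $S(H)$, it is the image of $H$ under $x\mapsto(x_{\phi(1)},\dots,x_{\phi(s)})$ in $Q^s$. Two connected cube subgraphs are ambient-isomorphic if they have the same canonical copy; a canonical cube subgraph is one which is the canonical copy of some connected cube subgraph. $\mathcal{L}(Y_1,\dots,Y_r)$ is the joint law; $\prod_j\mathrm{Po}(\lambda_j)$ is the law of independent Poisson variables with means $\lambda_j$; $d_{TV}$ is total variation distance between distributions on $\mathbb{Z}^r$. *)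

(* Defs.v *)
From mathcomp Require Import all_boot all_order all_algebra.

Set Implicit Arguments.
Unset Strict Implicit.
Unset Printing Implicit Defensive.

Import Order.TTheory GRing.Theory Num.Theory.

Local Open Scope ring_scope.

Definition cube (d : nat) := {ffun 'I_d -> bool}.

Definition cube_edges (d : nat) : {set {set cube d}} :=
  [set [set x; y] | x in [set: cube d], y in [set: cube d]
                  & #|[set i | x i != y i]| == 1%N].

(* A pair (vertices, edges), an edge being the set of its two ends.  That the
   pair is a graph at all is part of [connected_subgraph]. *)
Definition cubegraph (d : nat) : Type := ({set cube d} * {set {set cube d}})%type.

Definition vertices d (H : cubegraph d) : {set cube d} := H.1.
Definition edges d (H : cubegraph d) : {set {set cube d}} := H.2.

Definition adjacent d (E : {set {set cube d}}) : rel (cube d) :=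
  fun x y => [set x; y] \in E.

Definition connected_subgraph d (H : cubegraph d) : bool :=
  [&& edges H \subset cube_edges d,
      cover (edges H) \subset vertices H,
      vertices H != set0
    & [forall x in vertices H, forall y in vertices H,
         connect (adjacent (edges H)) x y]].

Definition gsupport d (H : cubegraph d) : {set 'I_d} :=
  [set i | [exists x : cube d, exists y : cube d,
              [&& [set x; y] \in edges H, ~~ x i & y i]]].

Definition gspan d (H : cubegraph d) : nat := #|gsupport H|.

(* [enum_val] enumerates a set of ordinals in increasing order: this is the
   increasing injection [phi] with image [gsupport H]. *)
Definition support_inj d (H : cubegraph d) : 'I_(gspan H) -> 'I_d :=
  @enum_val _ (mem (gsupport H)).

Lemma support_inj_incr d (H : cubegraph d) (i j : 'I_(gspan H)) :
  (i < j)%N -> (support_inj i < support_inj j)%N.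
Proof.
move=> ltij; pose x0 : 'I_d := support_inj i.
rewrite /support_inj !(enum_val_nth x0).
have srt : sorted ltn (map val (enum (gsupport H))).
  have -> : enum (gsupport H) = [seq x <- enum 'I_d | x \in gsupport H].
    by rewrite enumT.
  apply: (subseq_sorted ltn_trans (map_subseq val (filter_subseq _ _))).
  by rewrite val_enum_ord iota_ltn_sorted.
have szE : size (map val (enum (gsupport H))) = #|gsupport H|.
  by rewrite size_map -cardE.
have := sorted_ltn_nth ltn_trans (val x0) srt.
move=> /(_ i j); rewrite !inE szE => /(_ (ltn_ord i) (ltn_ord j) ltij).
by rewrite !(nth_map x0) // -cardE.
Qed.

Lemma support_inj_image d (H : cubegraph d) (k : 'I_d) :
  (k \in gsupport H) = [exists i, support_inj (H := H) i == k].
Proof.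
apply/idP/existsP => [kS | [i /eqP <-]]; last exact: enum_valP.
by exists (enum_rank_in kS k); rewrite /support_inj enum_rankK_in.
Qed.

Definition project d (H : cubegraph d) (x : cube d) : cube (gspan H) :=
  [ffun i => x (support_inj i)].

Definition cube_subgraph : Type := {d : nat & cubegraph d}.

(* For a single vertex, [gspan H = 0] and this is the one-vertex graph Q^0
   (see [canonical_copy1]), so no case distinction is needed. *)
Definition canonical_copy d (H : cubegraph d) : cube_subgraph :=
  Tagged cubegraph
    ([set project H x | x in vertices H],
     [set [set project H x | x in (e : {set cube d})] | e in edges H]
     : {set {set cube (gspan H)}}).

Lemma canonical_copy1 d (v : cube d) :
  canonical_copy ([set v], set0) = Tagged cubegraph ([set: cube 0], set0).
Proof.
have gen n (w : cube n) : n = 0%N ->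
    Tagged cubegraph ([set w], set0) = Tagged cubegraph ([set: cube 0], set0).
  move=> n0; subst n; suff -> : [set w] = [set: cube 0] by [].
  by apply/setP => z; rewrite !inE; apply/eqP/ffunP; case.
rewrite /canonical_copy /vertices /edges /= imset0 imset_set1; apply: gen.
apply/eqP; rewrite cards_eq0 -subset0; apply/subsetP => i.
by rewrite inE => /existsP[x /existsP[y]]; rewrite inE.
Qed.

Definition ambient_isomorphic d d' (H : cubegraph d) (H' : cubegraph d') : bool :=
  canonical_copy H == canonical_copy H'.

Definition is_canonical (K : cube_subgraph) : Prop :=
  exists d (H : cubegraph d), connected_subgraph H /\ canonical_copy H = K.

Definition num_vertices (K : cube_subgraph) : nat := #|vertices (tagged K)|.

Definition min_num_vertices r (hr : (0 < r)%N) (H : 'I_r -> cube_subgraph) : nat :=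
  num_vertices (H [arg min_(j < Ordinal hr) num_vertices (H j)]).

(* A spanning subgraph of the cube is given by its edge set [E]. *)
Definition component d (E : {set {set cube d}}) (x : cube d) : cubegraph d :=
  let V := [set y | connect (adjacent E) x y] in
  (V, [set e in E | e \subset V]).

Definition components d (E : {set {set cube d}}) : {set cubegraph d} :=
  [set component E x | x in [set: cube d]].

Definition num_components d (K : cube_subgraph) (E : {set {set cube d}}) : nat :=
  #|[set C in components E | ambient_isomorphic C (tagged K)]|.

From mathcomp Require Import all_classical all_reals all_analysis.

Section RandomSubgraph.
Context {R : realType}.
Implicit Types (p : R) (d r : nat).

(* The probability that [Q_p^d] has edge set [E], for [E] a set of cube edges. *)
Definition Qp_pmf p d (E : {set {set cube d}}) : R :=
  \prod_(e in cube_edges d) (if e \in E then p else 1 - p).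

Lemma Qp_pmf_sum1 p d : \sum_(E in powerset (cube_edges d)) Qp_pmf p E = 1.
Proof.
pose A := cube_edges d.
transitivity (\prod_(e : {set cube d})
    ((if e \in A then p else 0) + (if e \in A then 1 - p else 1))).
  rewrite bigA_distr [RHS](bigID (fun E => E \in powerset A)) /=.
  rewrite [X in _ = _ + X]big1 => [|E]; last first.
    rewrite powersetE => /subsetPn[e eE eA].
    by rewrite (bigD1 e) //= eE (negbTE eA) mul0r.
  rewrite addr0; apply: eq_bigr => E; rewrite powersetE => /fintype.subsetP sEA.
  rewrite /Qp_pmf big_mkcond /=; apply: eq_bigr => e _.
  by case: ifPn => eA; case: ifPn => // eE; rewrite (sEA _ eE) in eA.
by apply: big1 => e _; case: ifP; rewrite ?subrKC ?add0r.
Qed.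

Definition Qp_mean p d (X : {set {set cube d}} -> R) : R :=
  \sum_(E in powerset (cube_edges d)) Qp_pmf p E * X E.

Definition mean_components p d (K : cube_subgraph) : R :=
  @Qp_mean p d (fun E => (num_components K E)%:R).

Definition joint_law p d r (H : 'I_r -> cube_subgraph)
    (A : set {ffun 'I_r -> int}) : \bar R :=
  (\sum_(E in powerset (cube_edges d)
         | [ffun j => (num_components (H j) E)%:Z] \in A) Qp_pmf p E)%:E.

(* The point masses come from [poisson_prob] and not from [poisson_pmf], which
   is identically 1, instead of the mass function of the Dirac mass at 0, when
   the mean is 0.  The second argument of [poisson_prob] is a dummy. *)
Definition poisson_law r (lambda : 'I_r -> R)
    (A : set {ffun 'I_r -> int}) : \bar R :=
  (\esum_(k in A) \prod_(j < r)
     poisson_prob (lambda j) 0 (Posz @^-1` [set k j]))%E.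

Definition dTV (T : Type) (mu nu : set T -> \bar R) : \bar R :=
  ereal_sup [set `|mu A - nu A|%E | A in [set: set T]].

Definition log2 (x : R) : R := ln x / ln 2.

Definition max_size p : int := Num.floor (1 / log2 (1 / (1 - p))).

End RandomSubgraph.

(* Main.v *)
Require Import Defs.
From mathcomp Require Import all_boot all_order all_algebra.
From mathcomp Require Import polyrcf ring lra.
From mathcomp Require mpoly.

(** A component isomorphic to H_j is a copy C of H_j, present exactly when the edges meeting
    V(C) are the edges of C.  So copies whose incident edge sets are disjoint are independent,
    and the copies depending on a given one are O(d^v) in number, v = v(H_k), each of
    probability O(q^(vd)), because the span of a connected graph is smaller than its order.

    Write laws on N^r as elements of the algebra generated by the monomials X^k, with the l1
    norm.  Retaining each component with probability u and adding independent binomial numbers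
    of points of mean (1 - u) lambda_j gives a path from the binomial product law to the law of
    (Y_1, ..., Y_r).  By independence its derivative is a sum over dependent pairs of terms
    (X_j - 1)(X_k - 1) times a law with a binomial factor, of norm
    O(1 / ((1 - u) sqrt(lambda_j lambda_k))) by the smoothing of the binomial law; this cancels
    the number of pairs.  The trivial bound of this norm serves for 1 - u <= 2^-d, since
    lambda_j <= 2^d, and the integral of 1 / (1 - u) over the rest contributes the factor d.
    The number of binomial trials then tends to infinity. *)

Import Order.TTheory GRing.Theory Num.Theory.

Set Implicit Arguments.
Unset Strict Implicit.
Unset Printing Implicit Defensive.

Local Open Scope ring_scope.

(** * Smoothing by binomial laws *)

(** The means may be exponentially large in d, so bounding the derivative by the number of dependent
    pairs alone is too weak: each factor X_j - 1 has to gain the inverse square root of its own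
    mean. Both gains must come from the same binomial factor, even when j = k, which is why its
    trials come in two halves. The weight of dependent pairs of types j and k is at most M lambda_j
    and at most M lambda_k, hence at most M sqrt(lambda_j lambda_k), so the means cancel exactly,
    however different they are.

    Binomial factors, unlike Poisson ones, keep the path polynomial in u. A linear functional turns
    it into a real polynomial, to which the mean value theorem applies, and no limit is taken before
    the number of trials grows. Defining the norm by duality suits this: every estimate is tested on
    functionals bounded on the monomials. The functional used at the end is the sum of the
    coefficients over a finite set of outcomes; it is 0 or 1 on each monomial and gives the
    probability of that set. *)

Section BinomialMean.
Variables (R : realFieldType) (a : R).
Implicit Types (n : nat) (f g : nat -> R).

(** The recursion conditions on one trial, so that inductions on [n] need no binomial
    coefficients. *)
Fixpoint binomial_mean n f : R :=
  if n is n'.+1 then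
    (1 - a) * binomial_mean n' f + a * binomial_mean n' (f \o succn)
  else f 0%N.

Lemma binomial_mean_linear n c f g :
  binomial_mean n (fun k => c * f k + g k) =
  c * binomial_mean n f + binomial_mean n g.
Proof. by elim: n f g => //= n IHn f g; rewrite !IHn; ring. Qed.

Lemma binomial_mean_ext n f g : f =1 g -> binomial_mean n f = binomial_mean n g.
Proof.
elim: n f g => //= n IHn f g efg.
by rewrite (IHn f g) // (IHn (f \o succn) (g \o succn)) // => k /=; rewrite efg.
Qed.

Lemma binomial_meanZ n c f : binomial_mean n (fun k => c * f k) = c * binomial_mean n f.
Proof.
have h0 m : binomial_mean m (fun=> 0) = 0.
  by elim: m => //= m IHm; rewrite /comp IHm; ring.
rewrite -[RHS]addr0 -(h0 n) -binomial_mean_linear.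
by apply: binomial_mean_ext => k; rewrite addr0.
Qed.

Lemma binomial_mean_cst n c : binomial_mean n (fun=> c) = c.
Proof. by elim: n => //= n IHn; rewrite /comp IHn; ring. Qed.

(** Size biasing: weighting by the count singles out one successful trial among the [n.+1]. *)
Lemma binomial_mean_index n f :
  binomial_mean n.+1 (fun k => k%:R * f k) =
  n.+1%:R * a * binomial_mean n (f \o succn).
Proof.
elim: n f => [|n IHn] f; first by rewrite /=; ring.
have step : binomial_mean n.+1 ((fun k => k%:R * f k) \o succn) =
    binomial_mean n.+1 (fun k => k%:R * (f \o succn) k) + binomial_mean n.+1 (f \o succn).
  rewrite -[X in X + _]mul1r -binomial_mean_linear.
  by apply: binomial_mean_ext => k /=; rewrite -natr1; ring.
rewrite -[LHS]/((1 - a) * binomial_mean n.+1 _ + a * binomial_mean n.+1 _) step !IHn.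
by rewrite [binomial_mean n.+1 _]/= -!natr1; ring.
Qed.

(** The Stein identity of the binomial law. It turns the effect of a unit shift into a correlation
    with the centred count, whose size is controlled by the variance. *)
Lemma binomial_mean_stein n f :
  binomial_mean n.+1 (fun k => (k%:R - n.+1%:R * a) * f k) =
  n.+1%:R * a * (1 - a) * (binomial_mean n (f \o succn) - binomial_mean n f).
Proof.
rewrite (@binomial_mean_ext _ _ (fun k => - (n.+1%:R * a) * f k + k%:R * f k)).
  by rewrite binomial_mean_linear binomial_mean_index [binomial_mean n.+1 _]/=; ring.
by move=> k; ring.
Qed.

Hypothesis a01 : 0 <= a <= 1.

Lemma le_binomial_mean n f g :
  (forall k, f k <= g k) -> binomial_mean n f <= binomial_mean n g.
Proof.
case/andP: a01 => a0 a1; elim: n f g => //= n IHn f g lefg.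
by rewrite lerD // ler_wpM2l ?subr_ge0 ?IHn // => k /=.
Qed.

Lemma normr_binomial_mean n f :
  `|binomial_mean n f| <= binomial_mean n (fun k => `|f k|).
Proof.
rewrite ler_norml; apply/andP; split.
  rewrite -[X in - X]mul1r -mulNr -binomial_meanZ.
  by apply: le_binomial_mean => k; rewrite mulN1r lerNl -normrN ler_norm.
by apply: le_binomial_mean => k; apply: ler_norm.
Qed.

(** The Stein identity for the centred count itself, whose shift difference is 1. *)
Lemma binomial_variance n :
  binomial_mean n.+1 (fun k => (k%:R - n.+1%:R * a) ^+ 2) = n.+1%:R * a * (1 - a).
Proof.
rewrite (@binomial_mean_ext _ _
  (fun k => (k%:R - n.+1%:R * a) * (k%:R - n.+1%:R * a))) // binomial_mean_stein.
rewrite -[RHS]mulr1; congr (_ * _).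
rewrite addrC -mulN1r -binomial_mean_linear.
rewrite (@binomial_mean_ext _ _ (fun=> 1)) ?binomial_mean_cst // => k /=.
by rewrite -natr1; ring.
Qed.

(* The difference is the mean of (k - Na) f k / (Na(1-a)), N = n + 1, and AM-GM with
   weight s replaces the square root of the variance. *)
Lemma binomial_mean_smooth n f (c s : R) : 0 < s -> s ^+ 2 = n.+1%:R * a * (1 - a) ->
  (forall k, `|f k| <= c) ->
  `|binomial_mean n (f \o succn) - binomial_mean n f| <= c / s.
Proof.
move=> s0 s2 fc; have c0 : 0 <= c by apply: le_trans (fc 0%N).
have := binomial_mean_stein n f; rewrite -s2 => e.
have s2n0 : s ^+ 2 != 0 by rewrite expf_neq0 ?gt_eqF.
rewrite -[X in `|X|](mulKf s2n0) -e normrM normfV (ger0_norm (sqr_ge0 s)).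
rewrite ler_pdivrMl ?exprn_gt0 //; apply: le_trans (normr_binomial_mean _ _) _.
apply: (@le_trans _ _ (binomial_mean n.+1 (fun k =>
   c / (2 * s) * (k%:R - n.+1%:R * a) ^+ 2 + c * s / 2))).
  apply: le_binomial_mean => k; set D := _ - _.
  have {2}-> : D = `|D| * Num.sg D by rewrite mulrC -numEsg.
  rewrite normrM; apply: (@le_trans _ _ (`|D| * c)); first by rewrite ler_wpM2l.
  rewrite -subr_ge0.
  have -> : c / (2 * s) * (`|D| * Num.sg D) ^+ 2 + c * s / 2 - `|D| * c =
     c / (2 * s) * (`|D| - s) ^+ 2.
    have -> : (`|D| * Num.sg D) ^+ 2 = `|D| ^+ 2 by rewrite mulrC -numEsg real_normK ?num_real.
    by field; rewrite gt_eqF.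
  by rewrite mulr_ge0 ?sqr_ge0 // divr_ge0 // mulr_ge0 // ltW.
rewrite binomial_mean_linear binomial_variance binomial_mean_cst -s2.
by rewrite le_eqVlt; apply/orP; left; apply/eqP; field; rewrite gt_eqF.
Qed.

End BinomialMean.

(** * The l1 norm of laws, by duality *)

Section L1Bound.
Variables (R : rcfType) (A : comAlgType R) (r : nat) (X : 'I_r -> A).
Implicit Types (K L c : R) (P Q : A) (phi : A -> R) (m : 'I_r -> nat).

Definition monomial m : A := \prod_j X j ^+ m j.

(* By duality, [P] has l1 norm at most [K] in the basis of monomials. *)
Definition l1_bound K P := forall phi c, scalar phi ->
  (forall m, `|phi (monomial m)| <= c) -> `|phi P| <= K * c.

Lemma monomial_var j : X j = monomial (fun i => (i == j)).
Proof.
rewrite /monomial (bigD1 j) //= eqxx big1 ?mulr1 // => i /negbTE ->.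
by rewrite expr0.
Qed.

Lemma monomial1 : 1 = monomial (fun=> 0%N).
Proof. by rewrite /monomial big1. Qed.

Lemma monomialM m m' : monomial m * monomial m' = monomial (fun j => m j + m' j)%N.
Proof. by rewrite -big_split; apply: eq_bigr => j _; rewrite exprD. Qed.

Lemma scalarD phi P Q : scalar phi -> phi (P + Q) = phi P + phi Q.
Proof. by move=> h; have := h 1 P Q; rewrite scale1r mul1r. Qed.

Lemma scalar0 phi : scalar phi -> phi 0 = 0.
Proof. by move=> h; have := h (-1) 0 0; rewrite scaler0 add0r mulN1r addNr. Qed.

Lemma scalar_scale phi c P : scalar phi -> phi (c *: P) = c * phi P.
Proof. by move=> h; have := h c P 0; rewrite (scalar0 h) !addr0. Qed.

Lemma scalarB phi P Q : scalar phi -> phi (P - Q) = phi P - phi Q.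
Proof.
by move=> h; rewrite scalarD // -scaleN1r scalar_scale // mulN1r.
Qed.

Lemma scalar_sum phi (I : Type) (s : seq I) (p : pred I) (F : I -> A) :
  scalar phi -> phi (\sum_(i <- s | p i) F i) = \sum_(i <- s | p i) phi (F i).
Proof.
move=> h; apply: (big_morph phi); first by move=> P Q; apply: scalarD.
exact: scalar0.
Qed.

Lemma scalar_mulr phi Q : scalar phi -> scalar (fun P => phi (P * Q)).
Proof. by move=> h c P P'; rewrite mulrDl -scalerAl h. Qed.

Lemma l1_bound_monomial m : l1_bound 1 (monomial m).
Proof. by move=> phi c _ h; rewrite mul1r. Qed.

Lemma l1_bound_var j : l1_bound 1 (X j).
Proof. by rewrite monomial_var; apply: l1_bound_monomial. Qed.

Lemma l1_bound1 : l1_bound 1 1.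
Proof. by rewrite monomial1; apply: l1_bound_monomial. Qed.

Lemma l1_bound0 : l1_bound 0 0.
Proof. by move=> phi c /scalar0 -> _; rewrite normr0 mul0r. Qed.

Lemma l1_boundD K L P Q : l1_bound K P -> l1_bound L Q -> l1_bound (K + L) (P + Q).
Proof.
move=> hP hQ phi c s h; rewrite scalarD // (le_trans (ler_normD _ _)) //.
by rewrite mulrDl lerD ?(hP phi) ?(hQ phi).
Qed.

Lemma l1_boundZ K c P : l1_bound K P -> l1_bound (`|c| * K) (c *: P).
Proof.
by move=> hP phi e s h; rewrite scalar_scale // normrM -mulrA ler_wpM2l // hP.
Qed.

Lemma l1_boundN K P : l1_bound K P -> l1_bound K (- P).
Proof.
by move=> /(@l1_boundZ _ (-1)); rewrite scaleN1r normrN1 mul1r.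
Qed.

Lemma l1_boundW K L P : K <= L -> l1_bound K P -> l1_bound L P.
Proof.
move=> KL hP phi c s h; apply: le_trans (hP phi c s h) _.
by rewrite ler_wpM2r // (le_trans _ (h (fun=> 0%N))).
Qed.

(** The bound for [P] is applied to the functional that multiplies by [Q] before applying [phi]; its
    values on monomials are bounded through [Q], again after multiplication by a monomial. *)
Lemma l1_boundM K L P Q : l1_bound K P -> l1_bound L Q -> l1_bound (K * L) (P * Q).
Proof.
move=> hP hQ phi c s h; rewrite -mulrA.
apply: (hP (fun P => phi (P * Q)) (L * c)); first exact: scalar_mulr.
move=> m; rewrite mulrC.
apply: (hQ (fun Q => phi (Q * monomial m)) c); first exact: scalar_mulr.
by move=> m'; rewrite monomialM.
Qed.

Lemma l1_bound_sum (I : Type) (s : seq I) (p : pred I) (K : I -> R) (F : I -> A) :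
  (forall i, p i -> l1_bound (K i) (F i)) ->
  l1_bound (\sum_(i <- s | p i) K i) (\sum_(i <- s | p i) F i).
Proof.
move=> h; elim/big_ind2 : _ => //; first exact: l1_bound0.
by move=> *; apply: l1_boundD.
Qed.

Lemma l1_bound_prod1 (I : Type) (s : seq I) (p : pred I) (F : I -> A) :
  (forall i, p i -> l1_bound 1 (F i)) -> l1_bound 1 (\prod_(i <- s | p i) F i).
Proof.
move=> h; elim/big_ind : _ => //; first exact: l1_bound1.
by move=> P Q hP hQ; rewrite -[1]mulr1; apply: l1_boundM.
Qed.

Lemma l1_bound_exp1 n P : l1_bound 1 P -> l1_bound 1 (P ^+ n).
Proof.
move=> h; elim: n => [|n IHn]; first exact: l1_bound1.
by rewrite exprS -[1]mulr1; apply: l1_boundM.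
Qed.

(** Generating function of one point of type [j], present with probability [a]. In this form a
    change of [a] brings out the factor [X j - 1], which is the difference between adding a point of
    type [j] and not adding it. *)
Definition bernoulli_gf (a : R) j : A := 1 + a *: (X j - 1).

Lemma bernoulli_gfE a j : bernoulli_gf a j = (1 - a) *: 1 + a *: X j.
Proof. by rewrite /bernoulli_gf scalerBr scalerBl scale1r addrA addrAC. Qed.

Lemma l1_bound_gf a j : 0 <= a <= 1 -> l1_bound 1 (bernoulli_gf a j).
Proof.
case/andP=> a0 a1; rewrite bernoulli_gfE.
apply: (@l1_boundW (`|1 - a| * 1 + `|a| * 1)).
  by rewrite !ger0_norm ?subr_ge0 // !mulr1 subrK.
by apply: l1_boundD; apply: l1_boundZ; [apply: l1_bound1|apply: l1_bound_var].
Qed.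

Lemma l1_bound_sub1 j : l1_bound 2 (X j - 1).
Proof.
by apply: l1_boundD; [apply: l1_bound_var|apply: l1_boundN; apply: l1_bound1].
Qed.

(** The link between the algebra and binomial means. The power [i] is there for the induction, since
    a successful trial raises it by one. *)
Lemma scalar_gf phi a j n i : scalar phi ->
  phi (X j ^+ i * bernoulli_gf a j ^+ n) =
  binomial_mean a n (fun k => phi (X j ^+ (i + k))).
Proof.
move=> h; elim: n i => [|n IHn] i; first by rewrite /= addn0 mulr1.
have -> : X j ^+ i * bernoulli_gf a j ^+ n.+1 =
    (1 - a) *: (X j ^+ i * bernoulli_gf a j ^+ n) +
    a *: (X j ^+ i.+1 * bernoulli_gf a j ^+ n).
  rewrite exprS; move: (_ ^+ n) => T; rewrite bernoulli_gfE mulrDl mulrDr.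
  by rewrite -!scalerAl -!scalerAr mul1r mulrA -exprSr.
rewrite h (scalar_scale _ _ h) !IHn /=; congr (_ + _ * _).
by apply: binomial_mean_ext => k /=; rewrite addSnnS.
Qed.

Lemma l1_bound_smooth a j n s : 0 <= a <= 1 -> 0 < s ->
  s ^+ 2 = n.+1%:R * a * (1 - a) ->
  l1_bound s^-1 ((X j - 1) * bernoulli_gf a j ^+ n).
Proof.
move=> a01 s0 s2 phi c h hc; rewrite [_^-1 * _]mulrC.
have -> : phi ((X j - 1) * bernoulli_gf a j ^+ n) =
    phi (X j ^+ 1 * bernoulli_gf a j ^+ n) - phi (X j ^+ 0 * bernoulli_gf a j ^+ n).
  by rewrite -scalarB // -mulrBl.
rewrite !scalar_gf //.
apply: (@binomial_mean_smooth _ a a01 n (fun k => phi (X j ^+ k))) => // k.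
have -> : X j ^+ k = monomial (fun i => (i == j) * k)%N.
  rewrite /monomial (bigD1 j) //= eqxx mul1n big1 ?mulr1 // => i /negbTE ->.
  by rewrite expr0.
exact: hc.
Qed.

(** Telescoping: factors are dropped one at a time, each at the cost of [u] times a factor [X - 1].
    The bound is assumed on [(X - 1) * Q] as a whole, since it is [Q] that smooths the
    difference. *)
Lemma l1_bound_prod_sub1 (I : Type) (s : seq I) (t : I -> 'I_r) (u : R) (K : I -> R) Q :
  0 <= u <= 1 -> (forall i, 0 <= K i) ->
  (forall i, l1_bound (K i) ((X (t i) - 1) * Q)) ->
  l1_bound (\sum_(i <- s) K i) ((\prod_(i <- s) bernoulli_gf u (t i) - 1) * Q).
Proof.
move=> u01 K0 h; elim: s => [|i s IHs].
  by rewrite !big_nil subrr mul0r; apply: l1_bound0.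
rewrite !big_cons addrC.
have -> : (bernoulli_gf u (t i) * \prod_(j <- s) bernoulli_gf u (t j) - 1) * Q =
   (\prod_(j <- s) bernoulli_gf u (t j) - 1) * Q
   + u *: ((X (t i) - 1) * Q) * \prod_(j <- s) bernoulli_gf u (t j).
  rewrite {1}/bernoulli_gf; move: (\prod_(j <- s) _) (X _ - 1) => T D.
  rewrite [(1 + _) * T]mulrDl mul1r addrAC [in LHS]mulrDl -!scalerAl.
  by congr (_ + _ *: _); rewrite mulrAC.
apply: l1_boundD => //; rewrite -[K i]mulr1; apply: l1_boundM; last first.
  by apply: l1_bound_prod1 => k _; apply: l1_bound_gf.
apply: l1_boundW (l1_boundZ u (h i)).
have [/andP[u0 u1]] := u01; rewrite ger0_norm // ler_piMl //.
Qed.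
End L1Bound.

(** * Stein-Chen bound by interpolation *)

Lemma deriv_prod (A : comNzRingType) (I : eqType) (s : seq I) (p : pred I)
    (f : I -> {poly A}) : uniq s ->
  (\prod_(i <- s | p i) f i)^`() =
  \sum_(i <- s | p i) (f i)^`() * \prod_(j <- s | p j && (j != i)) f j.
Proof.
elim: s => [|x s IHs] /=; first by rewrite !big_nil derivC.
case/andP=> xs us; rewrite !big_cons; case: ifP => px; last first.
  rewrite IHs //; apply: eq_bigr => i pi; rewrite big_cons px /=.
  by [].
rewrite derivM IHs //; congr (_ + _).
  rewrite eqxx andbF; congr (_ * _).
  rewrite [LHS]big_seq_cond [RHS]big_seq_cond; apply: eq_bigl => j.
  by case: (boolP (j \in s)) => //= js; rewrite (memPn xs) ?andbT.
rewrite mulr_sumr [LHS]big_seq_cond [RHS]big_seq_cond; apply: eq_bigr => i /andP[si pi].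
have xi : x != i by apply: contraNneq xs => ->.
by rewrite big_cons px xi /=; apply: mulrCA.
Qed.

(** A discrete form of the integral of c / (1 - u). On the interval from 1 - 2^-l to 1 - 2^-(l+1)
    the first bound is at most c divided by the length, so each interval contributes c; there are L
    of them. The last one, up to 1, has length 2^-L and contributes c by the second bound. The
    contributions of e add up to e. *)
Lemma dyadic_increment (R : rcfType) (h : {poly R}) (c e : R) (L : nat) :
  0 <= c -> 0 <= e -> (forall u, 0 <= u < 1 -> `|h^`().[u]| <= c / (1 - u) + e) ->
  (forall u, 0 <= u <= 1 -> `|h^`().[u]| <= c * 2 ^+ L + e) ->
  `|h.[1] - h.[0]| <= c * L.+1%:R + e.
Proof.
move=> c0 e0 h1 h2.
have p2 l : 0 < 2 ^- l :> R by rewrite invr_gt0 exprn_gt0.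
have p21 l : 2 ^- l <= 1 :> R by rewrite invf_le1 ?exprn_gt0 // exprn_ege1 // ler1n.
have step l : `|h.[1 - 2 ^- l] - h.[0]| <= c * l%:R + e * (1 - 2 ^- l).
  elim: l => [|l IHl]; first by rewrite expr0 invr1 !subrr normr0 !mulr0 addr0.
  have e2 : 2 ^- l = 2 ^- l.+1 + 2 ^- l.+1 :> R.
    by rewrite exprS; field; rewrite expf_neq0 ?pnatr_eq0.
  have lt : 1 - 2 ^- l < 1 - 2 ^- l.+1 :> R by rewrite e2; have := p2 l.+1; lra.
  have [x xI ex] := poly_mvt h lt.
  have -> : h.[1 - 2 ^- l.+1] - h.[0] =
    (h.[1 - 2 ^- l.+1] - h.[1 - 2 ^- l]) + (h.[1 - 2 ^- l] - h.[0]) by ring.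
  rewrite ex; apply: le_trans (ler_normD _ _) _; move: xI; rewrite in_itv /= => /andP[x1 x2].
  have -> : 1 - 2 ^- l.+1 - (1 - 2 ^- l) = 2 ^- l.+1 :> R by rewrite e2; ring.
  have x0 : 0 <= x < 1 by have := p21 l; have := p2 l.+1; lra.
  rewrite normrM (ger0_norm (ltW (p2 _))).
  have -> : c * l.+1%:R + e * (1 - 2 ^- l.+1) =
    c + e * 2 ^- l.+1 + (c * l%:R + e * (1 - 2 ^- l)).
    by rewrite e2 -natr1; ring.
  rewrite lerD //; apply: le_trans (ler_wpM2r (ltW (p2 _)) (h1 x x0)) _.
  rewrite mulrDl lerD2r mulrAC ler_pdivrMr; last by have := p2 l.+1; lra.
  by rewrite ler_wpM2l //; have := p2 l.+1; lra.
have lt : 1 - 2 ^- L < 1 :> R by have := p2 L; lra.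
have [x xI ex] := poly_mvt h lt.
have -> : h.[1] - h.[0] = (h.[1] - h.[1 - 2 ^- L]) + (h.[1 - 2 ^- L] - h.[0]) by ring.
rewrite ex; apply: le_trans (ler_normD _ _) _; move: xI; rewrite in_itv /= => /andP[x1 x2].
have -> : 1 - (1 - 2 ^- L) = 2 ^- L :> R by ring.
have x0 : 0 <= x <= 1 by have := p21 L; have := p2 L; lra.
rewrite normrM (ger0_norm (ltW (p2 _))).
have -> : c * L.+1%:R + e = c + e * 2 ^- L + (c * L%:R + e * (1 - 2 ^- L)).
  by rewrite -natr1; ring.
rewrite lerD //; apply: le_trans (ler_wpM2r (ltW (p2 _)) (h2 x x0)) _.
by rewrite mulrDl lerD2r mulfK // expf_neq0 ?pnatr_eq0.
Qed.

Section ScalarHorner.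
Variables (R : rcfType) (A : comAlgType R) (phi : A -> R).
Hypothesis sphi : scalar phi.

(** At scalar points evaluation commutes with a linear functional, so a path in the algebra becomes
    a real polynomial. *)
Lemma horner_map_scalar (F : {poly A}) u : (map_poly phi F).[u] = phi F.[u%:A].
Proof.
rewrite (@horner_coef_wide _ (size F)) ?size_poly // horner_coef scalar_sum //.
apply: eq_bigr => i _; rewrite coef_map_id0 ?scalar0 //.
by rewrite exprZn expr1n mulr_algr scalar_scale // mulrC.
Qed.

Lemma deriv_map_scalar (F : {poly A}) : (map_poly phi F)^`() = map_poly phi F^`().
Proof.
apply/polyP => i; rewrite coef_deriv !coef_map_id0 ?scalar0 // coef_deriv.
by rewrite -mulr_natl -scaler_nat scalar_scale.
Qed.

End ScalarHorner.

(** * The derivative along the interpolation path *)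

Section SteinChen.
Variables (R : rcfType) (A : comAlgType R) (r : nat) (X : 'I_r -> A).
Variables (Omega B : finType) (w : Omega -> R) (S : Omega -> {set B}).
Variables (t : B -> 'I_r) (N : B -> {set B}).
Implicit Types (b c : B) (j k : 'I_r) (U V : {set B}) (u : R) (P Q : A).

Definition marginal b := \sum_(x | b \in S x) w x.
Definition joint b c := \sum_(x | (b \in S x) && (c \in S x)) w x.
Definition type_mean j := \sum_(b | t b == j) marginal b.
(** The summands of the two local terms of the Stein-Chen bound. The joint term leaves out [c = b],
    because [b] is removed from the set when its own factor is differentiated. *)
Definition near_weight b c := marginal b * marginal c + (if c != b then joint b c else 0).
Definition near_sum j k := \sum_(b | t b == j) \sum_(c in N b | t c == k) near_weight b c.

Hypothesis w0 : forall x, 0 <= w x.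
Hypothesis w1 : \sum_x w x = 1.
Hypothesis N_refl : forall b, b \in N b.
Hypothesis indep : forall b U,
  \sum_(x | (b \in S x) && (S x :\: N b == U)) w x =
  marginal b * \sum_(x | S x :\: N b == U) w x.

Local Notation gf := (bernoulli_gf X).

(** Generating function of the types of the members of [U] when each is retained independently with
    probability [u]. *)
Definition thinned_gf u U : A := \prod_(b in U) gf u (t b).

Lemma marginal_ge0 b : 0 <= marginal b.
Proof. by apply: sumr_ge0. Qed.

Lemma joint_ge0 b c : 0 <= joint b c.
Proof. by apply: sumr_ge0. Qed.

Lemma near_weight_ge0 b c : 0 <= near_weight b c.
Proof. by rewrite addr_ge0 ?mulr_ge0 ?marginal_ge0 //; case: ifP => // _; apply: joint_ge0. Qed.

Lemma type_mean_ge0 j : 0 <= type_mean j.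
Proof. by apply: sumr_ge0 => b _; apply: marginal_ge0. Qed.

Lemma near_sum_ge0 j k : 0 <= near_sum j k.
Proof. by apply: sumr_ge0 => b _; apply: sumr_ge0 => c _; apply: near_weight_ge0. Qed.

Lemma indep_mean b (g : {set B} -> A) :
  \sum_(x | b \in S x) w x *: g (S x :\: N b) =
  marginal b *: \sum_x w x *: g (S x :\: N b).
Proof.
rewrite (partition_big (fun x => S x :\: N b) predT) //=.
rewrite [in RHS](partition_big (fun x => S x :\: N b) predT) //= scaler_sumr.
apply: eq_bigr => U _.
rewrite (eq_bigr (fun x => w x *: g U)) => [|x /andP[_ /eqP ->] //].
rewrite [in RHS](eq_bigr (fun x => w x *: g U)) => [|x /eqP -> //].
by rewrite -!scaler_suml indep scalerA.
Qed.

Lemma l1_bound_comb (I : Type) (s : seq I) (p : pred I) (a K : I -> R) (F : I -> A) :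
  (forall i, p i -> 0 <= a i) -> (forall i, p i -> l1_bound X (K i) (F i)) ->
  l1_bound X (\sum_(i <- s | p i) a i * K i) (\sum_(i <- s | p i) a i *: F i).
Proof.
move=> a0 h; apply: l1_bound_sum => i pi; rewrite -{1}(ger0_norm (a0 i pi)).
exact: l1_boundZ (h i pi).
Qed.

Lemma thinned_gf_sub u U V : V \subset U ->
  thinned_gf u U = thinned_gf u V * thinned_gf u (U :\: V).
Proof.
move=> VU; rewrite /thinned_gf (big_setID V) /= (setIidPr VU) //.
Qed.

Lemma l1_bound_thinned_gf u U : 0 <= u <= 1 -> l1_bound X 1 (thinned_gf u U).
Proof. by move=> u01; apply: l1_bound_prod1 => b _; apply: l1_bound_gf. Qed.

(** Only the members of [U] outside [V] are paid for; the common factor has norm at most 1. *)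
Lemma l1_bound_thinned_gf_sub u U V (K : B -> R) Q : 0 <= u <= 1 -> V \subset U ->
  (forall c, 0 <= K c) -> (forall c, l1_bound X (K c) ((X (t c) - 1) * Q)) ->
  l1_bound X (\sum_(c in U :\: V) K c) ((thinned_gf u U - thinned_gf u V) * Q).
Proof.
move=> u01 VU K0 KQ; rewrite (thinned_gf_sub _ VU).
have -> : (thinned_gf u V * thinned_gf u (U :\: V) - thinned_gf u V) * Q =
   (thinned_gf u (U :\: V) - 1) * Q * thinned_gf u V.
  by rewrite !mulrBl mul1r (mulrC Q); congr (_ - _); rewrite -[LHS]mulrA [LHS]mulrC.
have := l1_boundM _ (l1_bound_thinned_gf V u01); rewrite /l1_bound.
move=> /(_ (\sum_(c in U :\: V) K c) _ _); rewrite mulr1; apply.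
rewrite /thinned_gf -!big_enum.
exact: (l1_bound_prod_sub1 _ u01 K0 KQ).
Qed.

Variable m : nat.
Hypothesis m0 : (0 < m)%N.

(** Success probability of each of [m] trials with total mean [(1 - u) * type_mean j]. *)
Definition rate u j := (1 - u) * type_mean j / m%:R.
Definition rest_gf u : A := \prod_j gf (rate u j) j ^+ m.
(** One trial of type [j] fewer: what remains when one of the [m] equal factors is
    differentiated. *)
Definition rest_gf' u j : A :=
  gf (rate u j) j ^+ m.-1 * \prod_(i | i != j) gf (rate u i) i ^+ m.

Lemma rest_gfE u j : rest_gf u = gf (rate u j) j * rest_gf' u j.
Proof. by rewrite /rest_gf (bigD1 j) //= mulrA -exprS prednK. Qed.

(* At ['X = u], the joint generating function of the members of [S] thinned at rate [u] and of
   independent binomial variables of means [(1 - u) * type_mean j]: the counts of [S] at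
   [u = 1], and the binomial product at [u = 0]. *)
Definition interpolation : {poly A} :=
  (\sum_x ((w x)%:A)%:P * \prod_(b in S x) (1 + 'X * (X (t b) - 1)%:P)) *
  \prod_j (1 + ((type_mean j / m%:R)%:A)%:P * ((1 - 'X) * (X j - 1)%:P)) ^+ m.

Lemma sub1_alg u : 1 - u%:A = (1 - u)%:A :> A.
Proof. by rewrite scalerBl scale1r. Qed.

Lemma horner_rest_factor u j :
  (1 + ((type_mean j / m%:R)%:A)%:P * ((1 - 'X) * (X j - 1)%:P)).[u%:A] = gf (rate u j) j.
Proof.
rewrite -!polyC1 hornerD !hornerM hornerD hornerN hornerX !hornerC sub1_alg.
rewrite !mulr_algl scalerA /bernoulli_gf /rate; congr (_ + _ *: _); ring.
Qed.

Lemma horner_deriv_rest_factor u j :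
  (1 + ((type_mean j / m%:R)%:A)%:P * ((1 - 'X) * (X j - 1)%:P))^`().[u%:A] =
  - ((type_mean j / m%:R) *: (X j - 1)).
Proof.
rewrite derivD -{1}polyC1 derivC add0r deriv_mulC derivM derivB derivX -{1}polyC1 derivC.
by rewrite derivC mulr0 addr0 sub0r mulN1r hornerM hornerN !hornerC mulrN mulr_algl.
Qed.

Lemma horner_thinned_factor u b :
  (1 + 'X * (X (t b) - 1)%:P).[u%:A] = gf u (t b).
Proof. by rewrite -!polyC1 hornerD hornerM hornerX !hornerC mulr_algl. Qed.

Lemma horner_interpolation u :
  interpolation.[u%:A] = (\sum_x w x *: thinned_gf u (S x)) * rest_gf u.
Proof.
rewrite /interpolation hornerM horner_sum horner_prod; congr (_ * _).
  apply: eq_bigr => x _; rewrite hornerM hornerC mulr_algl horner_prod.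
  by congr (_ *: _); apply: eq_bigr => b _; apply: horner_thinned_factor.
apply: eq_bigr => j _; rewrite horner_exp; congr (_ ^+ _).
exact: horner_rest_factor.
Qed.

(** The product rule. Thinning yields one term for each member [b] of [S x], with [b] taken out. The
    [m] equal factors of type [j] together yield minus [type_mean j], which is spread over the
    marginals of the [b] of type [j] so that the two sums can be compared term by term. *)
Lemma horner_deriv_interpolation u : interpolation^`().[u%:A] =
  (\sum_b \sum_(x | b \in S x) w x *: ((X (t b) - 1) * thinned_gf u (S x :\ b))) * rest_gf u
  - (\sum_x w x *: thinned_gf u (S x)) *
    \sum_b marginal b *: ((X (t b) - 1) * rest_gf' u (t b)).
Proof.
rewrite /interpolation derivM hornerD !hornerM; congr (_ * _ + _).
- rewrite (exchange_big_dep predT) //= (big_morph _ (@derivD A) (@deriv0 A)) horner_sum; apply: eq_bigr => x _.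
  rewrite deriv_mulC hornerM hornerC mulr_algl -scaler_sumr; congr (_ *: _).
  rewrite deriv_prod ?index_enum_uniq // horner_sum; apply: eq_bigr => b _.
  rewrite hornerM derivD -{1}polyC1 derivC add0r derivM derivX derivC mul1r mulr0 addr0 hornerC; congr (_ * _).
  rewrite horner_prod /thinned_gf; apply: eq_big => [c|c _].
    by rewrite !inE andbC.
  exact: horner_thinned_factor.
- rewrite horner_prod; apply: eq_bigr => j _; rewrite horner_exp; congr (_ ^+ _).
  exact: horner_rest_factor.
- rewrite -mulrN; congr (_ * _).
    rewrite horner_sum; apply: eq_bigr => x _; rewrite hornerM hornerC mulr_algl horner_prod.
    by congr (_ *: _); apply: eq_bigr => b _; apply: horner_thinned_factor.
  rewrite deriv_prod ?index_enum_uniq // horner_sum (partition_big t predT) //= -sumrN.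
  apply: eq_bigr => j _.
  rewrite (eq_bigr (fun b => marginal b *: ((X j - 1) * rest_gf' u j))); last first.
    by move=> b /eqP ->.
  rewrite -scaler_suml -/(type_mean j) hornerM horner_prod /rest_gf'.
  rewrite deriv_exp hornerMn hornerM horner_exp horner_deriv_rest_factor horner_rest_factor.
  rewrite (eq_bigr (fun i => gf (rate u i) i ^+ m)); last first.
    by move=> i _; rewrite horner_exp horner_rest_factor.
  rewrite mulNr mulNrn mulNr -scalerAl scalerMnl -mulr_natr divfK ?pnatr_eq0 -?lt0n //.
  by rewrite -scalerAl mulrA.
Qed.

Definition residual_swap u b : A := (X (t b) - 1) * rest_gf u.
Definition mixture u : A := \sum_x w x *: thinned_gf u (S x).

(** Both sums are compared with the one where [S x] is stripped of the whole neighbourhood [N b]. By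
    independence the stripped sums over x with [b \in S x] and over all x, the latter times the
    marginal of [b], agree and cancel. The last sum is the price for replacing m - 1 trials by m. *)
Lemma deriv_interpolation_split u : interpolation^`().[u%:A] =
  \sum_b \sum_(x | b \in S x) w x *:
     ((thinned_gf u (S x :\ b) - thinned_gf u (S x :\: N b)) * residual_swap u b)
  + \sum_b marginal b *: (\sum_x w x *:
     (- (thinned_gf u (S x) - thinned_gf u (S x :\: N b)) * residual_swap u b))
  + \sum_b marginal b *: (mixture u * ((X (t b) - 1) * (rest_gf u - rest_gf' u (t b)))).
Proof.
rewrite horner_deriv_interpolation -/(mixture u) mulr_suml mulr_sumr -sumrN -!big_split /=.
apply: eq_bigr => b _; have := indep_mean b (fun U => thinned_gf u U * residual_swap u b).
move=> /= e.
have -> : \sum_(x | b \in S x) w x *: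
     ((thinned_gf u (S x :\ b) - thinned_gf u (S x :\: N b)) * residual_swap u b) =
   \sum_(x | b \in S x) w x *: (thinned_gf u (S x :\ b) * residual_swap u b) -
   marginal b *: \sum_x w x *: (thinned_gf u (S x :\: N b) * residual_swap u b).
  by rewrite -e -sumrB; apply: eq_bigr => x _; rewrite mulrBl scalerBr.
have -> : \sum_x w x *:
     (- (thinned_gf u (S x) - thinned_gf u (S x :\: N b)) * residual_swap u b) =
   \sum_x w x *: (thinned_gf u (S x :\: N b) * residual_swap u b)
   - mixture u * residual_swap u b.
  rewrite /mixture mulr_suml -sumrB; apply: eq_bigr => x _.
  by rewrite opprB mulrBl scalerBr -scalerAl.
rewrite !mulrBr -/(residual_swap u b) !scalerBr -!addrA; congr (_ + _).
  rewrite mulr_suml; apply: eq_bigr => x _; rewrite /residual_swap -scalerAl; congr (_ *: _).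
  by rewrite mulrAC mulrC mulrA.
by rewrite !addrA addrNK addNr add0r -scalerAr.
Qed.

Lemma sum_near_weight (K : 'I_r -> 'I_r -> R) :
  \sum_b \sum_(c in N b) near_weight b c * K (t b) (t c) =
  \sum_j \sum_k near_sum j k * K j k.
Proof.
rewrite (partition_big t predT) //=; apply: eq_bigr => j _.
under [RHS]eq_bigr do rewrite /near_sum mulr_suml.
rewrite [RHS]exchange_big /=; apply: eq_bigr => b /eqP bj.
rewrite (partition_big t predT) //=; apply: eq_bigr => k _; rewrite mulr_suml.
by apply: eq_bigr => c /andP[_ /eqP ck]; rewrite bj ck.
Qed.

Lemma sum_exchange_set (p : pred Omega) (V : Omega -> {set B}) (K : B -> R) :
  \sum_(x | p x) w x * \sum_(c in V x) K c =
  \sum_c (\sum_(x | p x && (c \in V x)) w x) * K c.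
Proof.
under eq_bigr do rewrite mulr_sumr.
rewrite (exchange_big_dep predT) //=; apply: eq_bigr => c _.
by rewrite mulr_suml.
Qed.

(** Restoring the members of [N b] produces the joint weights when [b] occurs and the products of
    marginals otherwise. The norm [K] of the double difference stays a parameter because two bounds
    of it are used, one that blows up at u = 1 and one that does not. *)
Lemma l1_bound_deriv u (K : 'I_r -> 'I_r -> R) : 0 <= u <= 1 ->
  (forall j, rate u j <= 1) -> (forall j k, 0 <= K j k) ->
  (forall j k, l1_bound X (K j k) ((X k - 1) * ((X j - 1) * rest_gf u))) ->
  l1_bound X (\sum_j \sum_k near_sum j k * K j k + \sum_j 4 * type_mean j ^+ 2 / m%:R)
    interpolation^`().[u%:A].
Proof.
move=> u01 rate1 K0 hK; rewrite deriv_interpolation_split.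
have /andP[u0 u1] := u01.
have rate0 j : 0 <= rate u j.
  by rewrite /rate divr_ge0 ?ler0n // mulr_ge0 ?type_mean_ge0 // subr_ge0.
apply: l1_boundD; last first.
  apply: (@l1_boundW _ _ _ X (\sum_b marginal b * (1 * (4 * rate u (t b))))); last first.
    apply: l1_bound_comb => b _; first exact: marginal_ge0.
    apply: l1_boundM.
      rewrite -w1 /mixture -(eq_bigr _ (fun x _ => mulr1 (w x))).
      by apply: l1_bound_comb => x _ //; apply: l1_bound_thinned_gf.
    (* Taking out one trial costs a second factor [X - 1] and the factor [rate], which is of order
       1/m; the norm is at most 2 * 2 * [rate]. *)
    have -> : (X (t b) - 1) * (rest_gf u - rest_gf' u (t b)) =
        (X (t b) - 1) * (X (t b) - 1) * (rate u (t b) *: rest_gf' u (t b)).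
      have -> : rest_gf u - rest_gf' u (t b) =
          rate u (t b) *: ((X (t b) - 1) * rest_gf' u (t b)).
        by rewrite (rest_gfE _ (t b)) /bernoulli_gf mulrDl mul1r addrC addKr -scalerAl.
      by rewrite -!scalerAr mulrA.
    have -> : 4 * rate u (t b) = 2 * 2 * (`|rate u (t b)| * 1).
      by rewrite mulr1 ger0_norm // -natrM.
    apply: l1_boundM; first by apply: l1_boundM; apply: l1_bound_sub1.
    apply: l1_boundZ; rewrite -[1]mulr1; apply: l1_boundM.
      by apply: l1_bound_exp1; apply: l1_bound_gf; rewrite rate0 rate1.
    by apply: l1_bound_prod1 => i _; apply: l1_bound_exp1; apply: l1_bound_gf; rewrite rate0 rate1.
  rewrite (partition_big t predT) //=; apply: ler_sum => j _.
  rewrite (eq_bigr (fun b => marginal b * (4 * rate u j))); last first.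
    by move=> b /eqP ->; rewrite mul1r.
  rewrite -mulr_suml -/(type_mean j) /rate.
  have -> : type_mean j * (4 * ((1 - u) * type_mean j / m%:R)) =
     (1 - u) * (4 * type_mean j ^+ 2 / m%:R) by ring.
  by rewrite ler_piMl ?gerBl // divr_ge0 ?ler0n // mulr_ge0 ?ler0n ?sqr_ge0.
rewrite -sum_near_weight.
apply: (@l1_boundW _ _ _ X (
   \sum_b \sum_(x | b \in S x) w x *
      \sum_(c in (S x :\ b) :\: (S x :\: N b)) K (t b) (t c)
   + \sum_b marginal b * \sum_x w x * \sum_(c in S x :\: (S x :\: N b)) K (t b) (t c))).
  rewrite -big_split /= le_eqVlt; apply/orP; left; apply/eqP; apply: eq_bigr => b _.
  rewrite !sum_exchange_set mulr_sumr -big_split /= [RHS]big_mkcond /=.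
  apply: eq_bigr => c _; rewrite /near_weight /joint.
  case: ifP => cN; last first.
    rewrite !big_pred0 ?mul0r ?mulr0 ?addr0 // => x; rewrite !inE cN //=.
      by case: (c \in S x).
    by case: (c \in S x); rewrite ?andbF.
  have -> : \sum_(x | (b \in S x) && (c \in S x :\ b :\: (S x :\: N b))) w x =
      if c != b then joint b c else 0.
    case: ifP => cb; last by rewrite big_pred0 // => x; rewrite !inE cb /= !andbF.
    by apply: eq_bigl => x; rewrite !inE cN cb.
  have -> : \sum_(x | c \in S x :\: (S x :\: N b)) w x = marginal c.
    by apply: eq_bigl => x; rewrite !inE cN.
  by rewrite /joint; ring.
apply: l1_boundD.
  apply: l1_bound_sum => b _; apply: l1_bound_comb => x bS //.
  by apply: l1_bound_thinned_gf_sub => //; apply: setDS; rewrite sub1set N_refl.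
apply: l1_bound_comb => b _; first exact: marginal_ge0.
apply: l1_bound_comb => x _ //; rewrite mulNr; apply: l1_boundN.
by apply: l1_bound_thinned_gf_sub => //; apply: subsetDl.
Qed.

End SteinChen.

(** * Smoothing against the weight of dependent pairs *)

Section SteinChenBound.
Variables (R : rcfType) (A : comAlgType R) (r : nat) (X : 'I_r -> A).
Variables (Omega B : finType) (w : Omega -> R) (S : Omega -> {set B}).
Variables (t : B -> 'I_r) (N : B -> {set B}).

Hypothesis w0 : forall x, 0 <= w x.
Hypothesis w1 : \sum_x w x = 1.
Hypothesis N_refl : forall b, b \in N b.
Hypothesis indep : forall b U,
  \sum_(x | (b \in S x) && (S x :\: N b == U)) w x =
  marginal w S b * \sum_(x | S x :\: N b == U) w x.

Local Notation lam := (type_mean w S t).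
Local Notation near := (near_sum w S t N).

Variables (M : R) (L : nat).
Hypothesis M0 : 0 <= M.
Hypothesis near_le : forall j k, near j k <= M * lam j /\ near j k <= M * lam k.
Hypothesis lam_le : forall j, lam j <= 2 ^+ L.

Let lam0 j : 0 <= lam j. Proof. exact: type_mean_ge0. Qed.

(** The geometric mean of the two bounds in [near_le]. *)
Lemma near_sum_le_sqrt j k : near j k <= M * Num.sqrt (lam j * lam k).
Proof.
have [h1 h2] := near_le j k.
rewrite -[M]ger0_norm // -sqrtr_sqr -sqrtrM ?sqr_ge0 // -[near j k]ger0_norm ?near_sum_ge0 //.
rewrite -sqrtr_sqr; apply: ler_wsqrtr.
have -> : M ^+ 2 * (lam j * lam k) = (M * lam j) * (M * lam k) by ring.
by rewrite expr2 ler_pM // near_sum_ge0.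
Qed.

Variable n : nat.
Hypothesis n0 : (0 < n)%N.
Hypothesis lam_n : forall j, lam j <= n%:R.

Local Notation m := (n + n)%N.
Local Notation rt := (rate w S t m).

Lemma rate_bounds u j : 0 <= u <= 1 -> 0 <= rt u j <= 1 / 2.
Proof.
case/andP=> u0 u1; have ngt0 : 0 < n%:R :> R by rewrite ltr0n.
have mgt0 : 0 < m%:R :> R by rewrite ltr0n addn_gt0 n0.
rewrite /rate divr_ge0 ?ler0n ?mulr_ge0 ?lam0 ?subr_ge0 //=.
rewrite ler_pdivrMr // natrD; apply: (@le_trans _ _ (1 * lam j)).
  by rewrite ler_wpM2r ?lam0 ?gerBl.
by have := lam_n j; lra.
Qed.

(* n + n factors are split in two halves, one for each of the two differences. *)
Lemma l1_bound_two_swaps u (s : 'I_r -> R) j k : 0 <= u <= 1 ->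
  (forall i, i = j \/ i = k -> l1_bound X (s i) ((X i - 1) * bernoulli_gf X (rt u i) i ^+ n)) ->
  l1_bound X (s k * s j) ((X k - 1) * ((X j - 1) * rest_gf X w S t m u)).
Proof.
move=> u01 hs; pose G := \prod_i bernoulli_gf X (rt u i) i ^+ n.
have half i : i = j \/ i = k -> l1_bound X (s i) ((X i - 1) * G).
  move=> ijk; rewrite /G (bigD1 i) //= mulrA.
  have := l1_boundM (hs i ijk); move=> /(_ 1); rewrite mulr1; apply.
  apply: l1_bound_prod1 => l _; apply: l1_bound_exp1; apply: l1_bound_gf.
  by have := rate_bounds l u01; lra.
have -> : (X k - 1) * ((X j - 1) * rest_gf X w S t m u) =
    (X k - 1) * G * ((X j - 1) * G).
  have -> : rest_gf X w S t m u = G * G.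
    by rewrite /G -big_split; apply: eq_bigr => i _; rewrite exprD.
  by rewrite mulrACA mulrA.
by apply: l1_boundM; apply: half; [right|left].
Qed.

Lemma l1_bound_swap u j : 0 <= u <= 1 ->
  l1_bound X 2 ((X j - 1) * bernoulli_gf X (rt u j) j ^+ n).
Proof.
move=> u01; have := l1_boundM (@l1_bound_sub1 _ _ _ X j); move=> /(_ 1).
rewrite mulr1; apply; apply: l1_bound_exp1; apply: l1_bound_gf.
by have := rate_bounds j u01; lra.
Qed.

(** With a the rate, 2na = (1 - u) lambda_j, and a is at most 1/2 because lambda_j is at most n.
    Hence the variance (n + 1)a(1 - a) is at least na/2 = (1 - u) lambda_j / 4, which is where the 2
    comes from. *)
Lemma l1_bound_swap_smooth u j : 0 <= u < 1 -> 0 < lam j ->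
  l1_bound X (2 / Num.sqrt ((1 - u) * lam j))
    ((X j - 1) * bernoulli_gf X (rt u j) j ^+ n).
Proof.
case/andP=> u0 u1 lj; have u01 : 0 <= u <= 1 by rewrite u0 ltW.
have /andP[a0 a1] := rate_bounds j u01.
have v0 : 0 < (1 - u) * lam j by rewrite mulr_gt0 // subr_gt0.
have ngt0 : 0 < n%:R :> R by rewrite ltr0n.
have em : rt u j * (n%:R + n%:R) = (1 - u) * lam j.
  by rewrite /rate natrD divfK // gt_eqF // addr_gt0.
move: (rt u j) a0 a1 em => a a0 a1 em.
have vle : (1 - u) * lam j / 4 <= n.+1%:R * a * (1 - a).
  rewrite -em -[n.+1%:R]natr1.
  have h1 : 0 <= n%:R * a * (1 / 2 - a) by rewrite !mulr_ge0 //; lra.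
  have h2 : 0 <= a * (1 - a) by rewrite mulr_ge0 //; lra.
  by move: h1 h2; lra.
pose s := Num.sqrt (n.+1%:R * a * (1 - a)).
have s0 : 0 < s by rewrite sqrtr_gt0; apply: lt_le_trans vle; rewrite divr_gt0.
apply: (@l1_boundW _ _ _ X s^-1); last first.
  apply: l1_bound_smooth => //; first by rewrite a0; lra.
  by rewrite sqr_sqrtr //; apply: le_trans vle; rewrite divr_ge0 // ltW.
rewrite -[2 / _]invrK invf_div lef_pV2 ?posrE ?divr_gt0 ?sqrtr_gt0 //.
have -> : Num.sqrt ((1 - u) * lam j) / 2 = Num.sqrt ((1 - u) * lam j / 4).
  have -> : (1 - u) * lam j / 4 = (1 - u) * lam j * (2^-1) ^+ 2 by field.
  by rewrite [RHS]sqrtrM ?(ltW v0) // sqrtr_sqr ger0_norm ?invr_ge0 ?ler0n.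
  exact: ler_wsqrtr.
by rewrite -sqrtr_gt0.
Qed.

(** The value 4 is the trivial norm of a double difference. It is taken when one of the means
    vanishes, and then [near j k] vanishes too. *)
Definition swap_norm u j k : R :=
  if (0 < lam j) && (0 < lam k) then 4 / ((1 - u) * Num.sqrt (lam j * lam k)) else 4.

Lemma l1_bound_swap_norm u j k : 0 <= u < 1 ->
  l1_bound X (swap_norm u j k) ((X k - 1) * ((X j - 1) * rest_gf X w S t m u)).
Proof.
move=> u01'; have u01 : 0 <= u <= 1 by case/andP: u01' => -> /ltW.
rewrite /swap_norm; case: ifP => [/andP[lj lk]|_]; last first.
  have -> : 4 = 2 * 2 :> R by rewrite -natrM.
  by apply: (l1_bound_two_swaps (s := fun=> 2)) => // i _; apply: l1_bound_swap.
have /andP[u0 u1] := u01'.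
have v0 : 0 < 1 - u by rewrite subr_gt0.
have -> : 4 / ((1 - u) * Num.sqrt (lam j * lam k)) =
  2 / Num.sqrt ((1 - u) * lam k) * (2 / Num.sqrt ((1 - u) * lam j)).
  rewrite mulf_div -natrM; congr (_ / _).
  rewrite !sqrtrM ?ltW // mulrACA -expr2 sqr_sqrtr ?ltW //.
  by rewrite [X in _ = _ * X]mulrC.
apply: (l1_bound_two_swaps (s := fun i => 2 / Num.sqrt ((1 - u) * lam i))) => //.
by move=> i [] ->; apply: l1_bound_swap_smooth.
Qed.

Lemma near_sum_swap_norm u j k : 0 <= u < 1 ->
  near j k * swap_norm u j k <= 4 * M / (1 - u).
Proof.
case/andP=> u0 u1; have v0 : 0 < 1 - u by rewrite subr_gt0.
rewrite /swap_norm; case: ifP => [/andP[lj lk]|].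
  have s0 : 0 < Num.sqrt (lam j * lam k) by rewrite sqrtr_gt0 mulr_gt0.
  rewrite mulrA ler_pdivrMr ?mulr_gt0 //.
  have -> : 4 * M / (1 - u) * ((1 - u) * Num.sqrt (lam j * lam k)) =
    M * Num.sqrt (lam j * lam k) * 4 by field; rewrite gt_eqF.
  by rewrite ler_wpM2r // near_sum_le_sqrt.
move=> ljk; have -> : near j k = 0.
  apply/eqP; rewrite eq_le near_sum_ge0 // andbT.
  have [h1 h2] := near_le j k; move: h1 h2 ljk.
  have := lam0 j; have := lam0 k; rewrite !le_eqVlt => /predU1P[<- _ _|->].
    by rewrite mulr0.
  by case/predU1P=> [<-|->] //; rewrite mulr0.
by rewrite mul0r divr_ge0 ?mulr_ge0 // ltW.
Qed.

Local Notation F := (interpolation X w S t m).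

(** The increment of a real polynomial between 0 and 1, with c = 4 r^2 M: r^2 pairs of types, each
    contributing 4M / (1 - u), or 4M 2^L uniformly in u. *)
Theorem stein_chen (phi : A -> R) : scalar phi ->
  (forall e, `|phi (monomial X e)| <= 1) ->
  `|phi (\sum_x w x *: \prod_(b in S x) X (t b))
    - phi (\prod_j bernoulli_gf X (lam j / m%:R) j ^+ m)|
  <= 4 * r%:R ^+ 2 * M * L.+1%:R + \sum_j 4 * lam j ^+ 2 / m%:R.
Proof.
move=> sphi phi1; have m0 : (0 < m)%N by rewrite addn_gt0 n0.
set err := \sum_j 4 * lam j ^+ 2 / m%:R; have err0 : 0 <= err.
  by apply: sumr_ge0 => j _; rewrite divr_ge0 ?mulr_ge0 ?sqr_ge0.
have e1 : phi (\sum_x w x *: \prod_(b in S x) X (t b)) = (map_poly phi F).[1].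
  rewrite horner_map_scalar // horner_interpolation // [rest_gf _ _ _ _ _ _]big1 ?mulr1.
    by congr phi; apply: eq_bigr => x _; congr (_ *: _); apply: eq_bigr => b _;
      rewrite /bernoulli_gf scale1r addrC subrK.
  by move=> j _; rewrite /rate subrr !mul0r /bernoulli_gf scale0r addr0 expr1n.
have e0 : phi (\prod_j bernoulli_gf X (lam j / m%:R) j ^+ m) = (map_poly phi F).[0].
  rewrite horner_map_scalar // horner_interpolation //.
  have -> : \sum_x w x *: thinned_gf X t 0 (S x) = 1; last first.
    by rewrite mul1r; congr phi; apply: eq_bigr => j _; rewrite /rate subr0 mul1r.
  rewrite -[RHS]scale1r -w1 scaler_suml; apply: eq_bigr => x _; congr (_ *: _).
  by apply: big1 => b _; rewrite /bernoulli_gf scale0r addr0.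
have sum_le c (f : 'I_r -> 'I_r -> R) : (forall j k, f j k <= c) ->
    \sum_j \sum_k f j k <= r%:R ^+ 2 * c.
  move=> fc; apply: (@le_trans _ _ (\sum_(j < r) \sum_(k < r) c)).
    by apply: ler_sum => j _; apply: ler_sum => k _.
  by rewrite !sumr_const card_ord expr2 -mulrA !mulr_natl.
rewrite e1 e0; apply: dyadic_increment => //; first by rewrite !mulr_ge0 ?sqr_ge0.
- move=> u u01; have u01' : 0 <= u <= 1 by case/andP: u01 => -> /ltW.
  have rate1 j : rt u j <= 1 by have := rate_bounds j u01'; lra.
  have norm0 j k : 0 <= swap_norm u j k.
    case/andP: u01 => _ u1; rewrite /swap_norm; case: ifP => // _.
    by rewrite divr_ge0 // mulr_ge0 ?sqrtr_ge0 // subr_ge0 ltW.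
  have hb := l1_bound_deriv w0 w1 N_refl indep m0 u01' rate1 norm0
    (fun j k => l1_bound_swap_norm j k u01).
  rewrite deriv_map_scalar // horner_map_scalar //.
  apply: le_trans (hb phi 1 sphi phi1) _; rewrite mulr1 lerD2r.
  apply: le_trans (sum_le _ _ (fun j k => near_sum_swap_norm j k u01)) _.
  by rewrite le_eqVlt; apply/orP; left; apply/eqP; ring.
- move=> u u01; have rate1 j : rt u j <= 1 by have := rate_bounds j u01; lra.
  have h4 j k : l1_bound X 4 ((X k - 1) * ((X j - 1) * rest_gf X w S t m u)).
    have -> : 4 = 2 * 2 :> R by rewrite -natrM.
    by apply: (l1_bound_two_swaps (s := fun=> 2)) => // i _; apply: l1_bound_swap.
  have hb := l1_bound_deriv w0 w1 N_refl indep m0 u01 rate1 (fun _ _ => ler0n _ 4) h4.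
  rewrite deriv_map_scalar // horner_map_scalar //.
  apply: le_trans (hb phi 1 sphi phi1) _; rewrite mulr1 lerD2r.
  (* The trivial norm 4 is paired with [near j k <= M * lam j] and the crude bound on the mean. *)
  apply: le_trans (sum_le (4 * M * 2 ^+ L) _ _) _ => [j k|].
    have [h1 _] := near_le j k.
    rewrite mulrC -mulrA ler_wpM2l ?ler0n //; apply: le_trans h1 _.
    by rewrite ler_wpM2l.
  by rewrite le_eqVlt; apply/orP; left; apply/eqP; ring.
Qed.

End SteinChenBound.

(** * Subgraphs of the cube *)

Section CubeGraphs.
Variable d : nat.
Implicit Types (x y z : cube d) (V W : {set cube d}) (e : {set cube d}).
Implicit Types (E T : {set {set cube d}}) (C H : cubegraph d).

Definition incident V := [set e in cube_edges d | ~~ [disjoint e & V]].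

Lemma cube_edgesP e :
  reflect (exists x y, e = [set x; y] /\ #|[set i | x i != y i]| = 1%N)
          (e \in cube_edges d).
Proof.
apply: (iffP imset2P) => [[x y _] | [x [y [-> h]]]].
  by rewrite !inE => /eqP h ->; exists x, y.
by exists x y; rewrite ?inE ?h.
Qed.

Lemma adjacent_sym E : symmetric (adjacent E).
Proof. by move=> x y; rewrite /adjacent setUC. Qed.

Lemma incidentP V e :
  reflect (e \in cube_edges d /\ exists2 x, x \in e & x \in V) (e \in incident V).
Proof.
rewrite inE; apply: (iffP andP) => -[he h]; split => //.
  by have /pred0Pn[x /andP[/= xe xV]] := h; exists x.
by case: h => x xe xV; apply/pred0Pn; exists x; rewrite /= xe xV.
Qed.

Lemma edge_other_end e x : e \in cube_edges d -> x \in e -> exists y, e = [set x; y].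
Proof.
case/cube_edgesP=> a [b [-> _]]; rewrite in_set2 => /orP[]/eqP->; first by exists b.
by exists a; rewrite setUC.
Qed.

Lemma connect_invariant E (P : pred (cube d)) x y :
  (forall a b, [set a; b] \in E -> P a -> P b) ->
  connect (adjacent E) x y -> P x -> P y.
Proof.
move=> h /connectP[s]; elim: s x => [|z s IHs] x /=; first by move=> _ ->.
by case/andP=> xz zs yl Px; apply: (IHs z) => //; apply: h xz Px.
Qed.

Lemma connected_subgraphP C :
  reflect [/\ edges C \subset cube_edges d,
     forall e, e \in edges C -> e \subset vertices C,
     exists x, x \in vertices C &
     forall x y, x \in vertices C -> y \in vertices C -> connect (adjacent (edges C)) x y]
   (connected_subgraph C).
Proof.
apply: (iffP and4P) => [[h1 h2 h3 h4]|[h1 h2 h3 h4]]; split => //.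
- by move=> e eC; apply: subset_trans h2; apply: bigcup_sup.
- by have /set0Pn := h3.
- by move=> x y xV yV; move/forall_inP: h4 => /(_ x xV)/forall_inP/(_ y yV).
- by apply/bigcupsP.
- by apply/set0Pn.
- by apply/forall_inP => x xV; apply/forall_inP => y; apply: h4.
Qed.

(** From right to left: every edge of [E] that meets the vertex set is an edge of [C], so paths of
    [E] cannot leave it, while connectedness of [C] lets them reach all of it. The condition on [E]
    thus involves incident edges only. *)
Lemma mem_components E C : E \subset cube_edges d ->
  (C \in components E) = connected_subgraph C && (E :&: incident (vertices C) == edges C).
Proof.
move=> EQ; apply/imsetP/andP => [[x _ ->]|[/connected_subgraphP[hT hV [x xV] hc] /eqP hE]].
  set V := vertices _; set T := edges _.
  have VE y : (y \in V) = connect (adjacent E) x y by rewrite inE.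
  have TE e : (e \in T) = (e \in E) && (e \subset V) by rewrite inE.
  have xV : x \in V by rewrite VE.
  have VT y : y \in V -> connect (adjacent T) x y.
    (* Membership in [V] is carried along the path, because an edge of [E] is in [T] only when both
       its ends are in [V]. *)
    rewrite VE => xy; have : (y \in V) && connect (adjacent T) x y; last by case/andP.
    apply: (@connect_invariant E (fun y => (y \in V) && connect (adjacent T) x y)) xy _.
      move=> a b ab /andP[aV xa]; have bV : b \in V.
        by rewrite VE; apply: connect_trans (connect1 ab); rewrite -VE.
      rewrite bV; apply: connect_trans xa (connect1 _).
      by rewrite /adjacent TE ab; apply/subsetP => z; rewrite in_set2 => /orP[]/eqP->.
    by rewrite xV connect0.
  split.
    apply/connected_subgraphP; split.
    - by apply/subsetP => e; rewrite TE => /andP[eE _]; apply: (subsetP EQ).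
    - by move=> e; rewrite TE => /andP[].
    - by exists x.
    - move=> y z yV zV; apply: connect_trans (VT z zV).
      by rewrite (sym_connect_sym (@adjacent_sym T)); apply: VT.
  apply/eqP/setP => e; rewrite TE in_setI; apply/andP/andP => -[eE h]; split => //.
    have /incidentP[eQ [a ae aV]] := h; have [b eab] := edge_other_end eQ ae.
    apply/subsetP => z; rewrite eab in_set2 => /orP[]/eqP-> //.
    rewrite VE; apply: (@connect_trans _ _ a); first by rewrite -VE.
    by apply: connect1; rewrite /adjacent -eab.
  have eQ := subsetP EQ _ eE; apply/incidentP; split=> //.
  have /cube_edgesP[a [b [eab _]]] := eQ; exists a; first by rewrite eab !inE eqxx.
  by apply: (subsetP h); rewrite eab !inE eqxx.
exists x => //; have TE e : e \in edges C -> e \in E.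
  by rewrite -hE inE => /andP[].
have VE : vertices C = [set y | connect (adjacent E) x y].
  apply/setP => y; rewrite inE; apply/idP/idP => [yV|].
    apply: connect_sub (hc x y xV yV) => a b ab; apply: connect1; exact: TE.
  move=> xy; apply: (@connect_invariant E (mem (vertices C)) x y) => //= a b ab aV.
  have : [set a; b] \in edges C.
    rewrite -hE inE ab; apply/incidentP; split; first exact: (subsetP EQ).
    by exists a; rewrite ?inE ?eqxx.
  by move/hV/subsetP; apply; rewrite !inE eqxx orbT.
rewrite /component -VE [C]surjective_pairing; congr (_, _).
apply/setP => e; rewrite inE; apply/idP/andP => [eT|[eE eV]].
  by split; [apply: TE | apply: hV].
rewrite -[C.2]/(edges C) -hE inE eE; apply/incidentP; split; first exact: (subsetP EQ).
have /cube_edgesP[a [b [eab _]]] := subsetP EQ _ eE; exists a; rewrite ?eab ?inE ?eqxx //.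
by apply: (subsetP eV); rewrite eab !inE eqxx.
Qed.

End CubeGraphs.

(** * Boundaries, supports and numbers of copies *)

Section CubeGraphCounting.
Variable d : nat.
Implicit Types (x y z : cube d) (V W : {set cube d}) (e : {set cube d}).
Implicit Types (E T : {set {set cube d}}) (C H : cubegraph d).

Definition flip x (i : 'I_d) : cube d := [ffun j => if j == i then ~~ x j else x j].

Lemma flip_neq x i : (flip x i == x) = false.
Proof. by apply/eqP => /ffunP/(_ i); rewrite ffunE eqxx; case: (x i). Qed.

Lemma flip_inj x : injective (flip x).
Proof.
move=> i j /ffunP/(_ i); rewrite !ffunE eqxx; case: (i =P j) => // _.
by case: (x i).
Qed.

Lemma flip_diff x i j : (x j != flip x i j) = (j == i).
Proof. by rewrite ffunE; case: (j =P i) => _; case: (x j). Qed.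

Lemma flip_edge x i : [set x; flip x i] \in cube_edges d.
Proof.
apply/cube_edgesP; exists x, (flip x i); split=> //.
rewrite -(cards1 i); congr #|pred_of_set _|; apply/setP => j.
by rewrite !inE flip_diff.
Qed.

Lemma diff1_flip x y : #|[set i | x i != y i]| = 1%N -> exists i, y = flip x i.
Proof.
move/eqP/cards1P=> [i /setP h]; exists i; apply/ffunP => j; rewrite ffunE.
have := h j; rewrite !inE => <-.
by case: (x j); case: (y j).
Qed.

Lemma edge_flip e x : e \in cube_edges d -> x \in e -> exists i, e = [set x; flip x i].
Proof.
case/cube_edgesP=> a [b [-> h]]; rewrite in_set2 => /orP[]/eqP->.
  by have [i ->] := diff1_flip h; exists i.
have h' : #|[set i | b i != a i]| = 1%N.
  by rewrite -h; congr #|pred_of_set _|; apply/setP => i; rewrite !inE eq_sym.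
by have [i ->] := diff1_flip h'; exists i; rewrite setUC.
Qed.

Lemma pair_edge_flip x y : [set x; y] \in cube_edges d -> exists i, y = flip x i.
Proof.
move=> h; have [|i ei] := edge_flip h (x := x); first by rewrite !inE eqxx.
exists i; have : y \in [set x; flip x i] by rewrite -ei !inE eqxx orbT.
rewrite in_set2 => /orP[/eqP yx|/eqP //].
have : flip x i \in [set x; y] by rewrite ei !inE eqxx orbT.
by rewrite yx !inE orbb flip_neq.
Qed.

Definition boundary V := [set e in incident V | ~~ (e \subset V)].

(** Each vertex of [V] has d directions. Those that leave [V] correspond to distinct boundary edges;
    those that stay correspond to distinct ordered pairs of vertices of [V]. *)
Lemma leq_card_boundary V : (#|V| * d <= #|boundary V| + #|V| ^ 2)%N.
Proof.
pose D := [set q : cube d * 'I_d | q.1 \in V].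
have -> : (#|V| * d)%N = #|D|.
  transitivity #|setX V [set: 'I_d]|; first by rewrite cardsX cardsT card_ord.
  congr #|pred_of_set _|.
  by apply/setP => -[x i]; rewrite !inE andbT.
rewrite -(cardsID [set q : cube d * 'I_d | flip q.1 q.2 \in V]) addnC leq_add //.
  pose f (q : cube d * 'I_d) := [set q.1; flip q.1 q.2].
  rewrite -(@card_in_imset _ _ f) ?subset_leq_card //; last first.
    move=> [x i] [y j]; rewrite !inE /= => /andP[xi xV] /andP[yj yV] eq.
    (* A boundary edge has only one end in [V], so it determines its base vertex. *)
    have exy : x = y.
      have : x \in f (y, j) by rewrite -eq !inE eqxx.
      rewrite in_set2 => /orP[/eqP //|/eqP /= exj].
      by rewrite -exj xV in yj.
    subst y; congr (_, _); have : flip x i \in f (x, j) by rewrite -eq !inE eqxx orbT.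
    by rewrite in_set2 flip_neq => /eqP/flip_inj.
  apply/subsetP => e /imsetP[[x i]]; rewrite !inE /= => /andP[xi xV] ->.
  rewrite flip_edge /=; apply/andP; split.
    by apply/pred0Pn; exists x; rewrite /= xV !inE eqxx.
  by apply: contra xi => /subsetP; apply; rewrite !inE eqxx orbT.
pose g (q : cube d * 'I_d) := (q.1, flip q.1 q.2).
rewrite expnS expn1 -cardsX -(@card_in_imset _ _ g) ?subset_leq_card //.
  by apply/subsetP => _ /imsetP[[x i] h ->]; move: h; rewrite !inE.
by move=> [x i] [y j] _ _ [-> /flip_inj ->].
Qed.

(** An edge that meets both of two disjoint sets is the pair of an end in each. *)
Lemma card_boundary_incident V W : [disjoint V & W] ->
  (#|boundary W :&: incident V| <= #|V| * #|W|)%N.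
Proof.
move=> dVW; rewrite -cardsX.
apply: leq_trans (leq_imset_card (fun q : cube d * cube d => [set q.1; q.2]) _).
apply/subset_leq_card/subsetP => e; rewrite in_setI => /andP[].
rewrite inE => /andP[/incidentP[eQ [y ye yW]] _] /incidentP[_ [x xe xV]].
have xy : x != y by apply: contraTneq yW => <-; rewrite (disjointFr dVW).
apply/imsetP; exists (x, y); first by rewrite !inE xV.
have [i ei] := edge_flip eQ xe; move: ye; rewrite ei in_set2 => /orP[/eqP yx|/eqP -> //].
by rewrite yx eqxx in xy.
Qed.

Lemma components_disjoint E C C' : C \in components E -> C' \in components E ->
  C != C' -> [disjoint vertices C & vertices C'].
Proof.
case/imsetP=> x _ -> /imsetP[y _ ->]; apply: contraNT => /pred0Pn[z /=].
rewrite !inE => /andP[xz yz].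
have sym := sym_connect_sym (@adjacent_sym d E).
have xy : connect (adjacent E) x y by apply: connect_trans xz _; rewrite sym.
apply/eqP; rewrite /component.
suff -> : [set z | connect (adjacent E) x z] = [set z | connect (adjacent E) y z] by [].
by apply/setP => u; rewrite !inE (same_connect sym xy).
Qed.

(** No edge of [C] changes coordinate [i], so it is constant along paths. *)
Lemma off_support C x y i : connected_subgraph C -> x \in vertices C -> y \in vertices C ->
  i \notin gsupport C -> x i = y i.
Proof.
move=> /connected_subgraphP[_ _ _ hc] xV yV iS; apply/esym/eqP.
apply: (connect_invariant (P := fun z => z i == x i) _ (hc x y xV yV)) => // a b ab /eqP <-.
apply: contraNT iS; rewrite inE => ne.
case ai: (a i); case bi: (b i); rewrite ai bi in ne => //.
  by apply/existsP; exists b; apply/existsP; exists a; rewrite setUC ab ai bi.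
by apply/existsP; exists a; apply/existsP; exists b; rewrite ab ai bi.
Qed.

(* A set of vertices grown along edges gains at most one direction per new vertex. *)
Lemma span_lt_card C : connected_subgraph C -> (gspan C < #|vertices C|)%N.
Proof.
move=> cC; have [hQ hV [x0 x0V] hc] := connected_subgraphP C cC.
pose dirs W : {set 'I_d} := [set i | [exists y in W, y i != x0 i]].
pose good W := [&& W \subset vertices C, x0 \in W & (#|dirs W| < #|W|)%N].
have g0 : good [set x0].
  rewrite /good sub1set x0V set11 cards1 ltnS leqn0 cards_eq0 /=; apply/eqP/setP => i.
  by rewrite !inE; apply/existsP => -[y]; rewrite inE => /andP[/eqP ->]; rewrite eqxx.
case: (arg_maxnP (fun W : {set cube d} => #|W|) g0) => W /and3P[WV x0W ltW] maxW.
have WE : W = vertices C.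
  apply/eqP; rewrite eqEsubset WV; apply/subsetP => y yV.
  apply: (connect_invariant (P := mem W) _ (hc x0 y x0V yV)) => //= a b ab aW.
  apply: contraT => bW; have /pair_edge_flip[i bi] := subsetP hQ _ ab.
  have gb : good (b |: W).
    rewrite /good subUset WV sub1set !inE x0W orbT andbT /=.
    apply/andP; split; first by apply: (subsetP (hV _ ab)); rewrite !inE eqxx orbT.
    rewrite cardsU1 bW; apply: (@leq_ltn_trans #|i |: dirs W|).
      apply/subset_leq_card/subsetP => j; rewrite !inE => /existsP[z].
      rewrite !inE => /andP[/orP[/eqP->|zW] ne].
        case: (eqVneq j i) => //= ji; apply/existsP; exists a; rewrite aW /=.
        by move: ne; rewrite bi ffunE (negbTE ji).
      by apply/orP; right; apply/existsP; exists z; rewrite zW.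
    by rewrite cardsU1 -addnS leq_add // leq_b1.
  by have := maxW _ gb; rewrite cardsU1 bW /= ltnn.
rewrite -WE; apply: leq_ltn_trans ltW; apply/subset_leq_card/subsetP => i.
rewrite !inE => /existsP[x /existsP[y /and3P[xy xi yi]]].
have xW : x \in W by rewrite WE; apply: (subsetP (hV _ xy)); rewrite !inE eqxx.
have yW : y \in W by rewrite WE; apply: (subsetP (hV _ xy)); rewrite !inE eqxx orbT.
case x0i: (x0 i); apply/existsP.
  by exists x; rewrite xW (negbTE xi).
by exists y; rewrite yW yi.
Qed.

Lemma project_inj C : connected_subgraph C -> {in vertices C &, injective (project C)}.
Proof.
move=> cC x y xV yV /ffunP h; apply/ffunP => k.
case: (boolP (k \in gsupport C)) => [|kS]; last exact: off_support cC _ _ kS.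
by rewrite support_inj_image => /existsP[i /eqP <-]; have := h i; rewrite !ffunE.
Qed.

Lemma num_vertices_canonical_copy C : connected_subgraph C ->
  num_vertices (canonical_copy C) = #|vertices C|.
Proof. by move=> cC; apply: card_in_imset; apply: project_inj. Qed.

(** [None] stands for the vertex itself, [Some i] for its neighbour in direction [i]. *)
Definition closed_nbhd V : {set cube d} :=
  [set oapp (flip q.1) q.1 q.2 | q in setX V [set: option 'I_d]].

Lemma card_closed_nbhd V : (#|closed_nbhd V| <= #|V| * d.+1)%N.
Proof. by apply: leq_trans (leq_imset_card _ _) _; rewrite cardsX cardsT card_option card_ord. Qed.

(* The only copy of [K] through [y] with support given by [f]. *)
Definition place (K : cube_subgraph) y (f : {ffun 'I_(tag K) -> 'I_d}) : cubegraph d :=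
  let pr x : cube (tag K) := [ffun i => x (f i)] in
  let V := [set x | (pr x \in vertices (tagged K)) &&
                    [forall k, (k \in codom f) || (x k == y k)]] in
  (V, [set e in cube_edges d | (e \subset V) && ([set pr x | x in (e : {set cube d})] \in edges (tagged K))]).

Lemma placeE C y : connected_subgraph C -> y \in vertices C ->
  place (K := canonical_copy C) y [ffun i => support_inj (H := C) i] = C.
Proof.
move=> cC yV; have [hQ hV _ _] := connected_subgraphP C cC.
have prE x : [ffun i : 'I_(gspan C) => x ([ffun i => support_inj (H := C) i] i)] = project C x.
  by apply/ffunP => i; rewrite !ffunE.
have codE k : (k \in codom [ffun i => support_inj (H := C) i]) = (k \in gsupport C).
  rewrite support_inj_image; apply/codomP/existsP => [[i ->]|[i /eqP <-]].
    by exists i; rewrite ffunE.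
  by exists i; rewrite ffunE.
have VE : vertices (place (K := canonical_copy C) y [ffun i => support_inj (H := C) i]) = vertices C.
  apply/setP => x; rewrite inE /= prE; apply/andP/idP => [[/imsetP[z zV ez] /forallP h]|xV].
    suff -> : x = z by [].
    apply/ffunP => k; have := h k; rewrite codE => /orP[|/eqP xy].
      rewrite support_inj_image => /existsP[i /eqP <-].
      by move/ffunP: ez => /(_ i); rewrite !ffunE.
    case: (boolP (k \in gsupport C)) => [|kS]; last by rewrite xy; apply: off_support kS.
    rewrite support_inj_image => /existsP[i /eqP <-].
    by move/ffunP: ez => /(_ i); rewrite !ffunE.
  split; first by apply/imsetP; exists x.
  apply/forallP => k; rewrite codE; case: (boolP (k \in _)) => //= kS.
  by apply/eqP; apply: off_support kS.
rewrite [LHS]surjective_pairing [RHS]surjective_pairing; congr (_, _); first exact: VE.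
have sE (e : {set cube d}) : (e \subset
    vertices (place (K := canonical_copy C) y [ffun i => support_inj (H := C) i])) =
    (e \subset vertices C) by rewrite VE.
apply/setP => e; rewrite inE [e \subset _]sE.
have im_pr : [set [ffun i : 'I_(gspan C) => (x : cube d) ([ffun i => support_inj (H := C) i] i)]
    | x in (e : {set cube d})]
   = [set project C x | x in e] by apply: eq_imset => x; apply: prE.
rewrite im_pr; apply/and3P/idP => [[eQ eV /imsetP[e' e'E ee']]|eE]; last first.
  by split; [apply: (subsetP hQ) | apply: hV | apply/imsetP; exists e].
suff -> : e = e' by [].
(* An edge of [C] is recovered from its image because the projection is injective on the vertices of
   [C]. *)
have sub (a b : {set cube d}) : a \subset vertices C -> b \subset vertices C ->
    [set project C x | x in a] = [set project C x | x in b] -> a \subset b.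
  move=> aV bV ab; apply/subsetP => x xa; have : project C x \in [set project C x | x in b].
    by rewrite -ab; apply/imsetP; exists x.
  case/imsetP=> z zb /project_inj e1; rewrite e1 //.
    exact: (subsetP aV).
  exact: (subsetP bV).
by apply/eqP; rewrite eqEsubset; apply/andP; split; apply: sub => //; apply: hV.
Qed.

(** A shared incident edge has an end in [V] and an end in the copy, so some vertex of the copy lies
    in [closed_nbhd V]. That vertex and the injection of the support determine the copy. *)
Lemma count_copies_near V (K : cube_subgraph) :
  (#|[set C : {set cube d} * {set {set cube d}} |
       [&& connected_subgraph C, canonical_copy C == K &
           ~~ [disjoint incident V & incident (vertices C)]]]|
    <= #|V| * d.+1 * d ^ tag K)%N.
Proof.
apply: (@leq_trans #|setX (closed_nbhd V) [set: {ffun 'I_(tag K) -> 'I_d}]|); last first.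
  by rewrite cardsX cardsT card_ffun !card_ord leq_mul // card_closed_nbhd.
apply: leq_trans (leq_imset_card (fun q => place q.1 q.2) _).
apply/subset_leq_card/subsetP => C; rewrite inE => /and3P[cC /eqP <-].
case/pred0Pn=> e /= /andP[/incidentP[eQ [x xe xV]] /incidentP[_ [y ye yC]]].
apply/imsetP; exists (y, [ffun i => support_inj (H := C) i]); last by rewrite /= placeE.
rewrite !inE andbT; apply/imsetP; have [i ei] := edge_flip eQ xe.
move: ye; rewrite ei in_set2 => /orP[]/eqP->.
  by exists (x, None); rewrite ?inE ?xV.
by exists (x, Some i); rewrite ?inE ?xV.
Qed.

End CubeGraphCounting.

Lemma canonical_copy_full s (H : cubegraph s) : gsupport H = [set: 'I_s] ->
  canonical_copy H = Tagged cubegraph H.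
Proof.
move=> HT; have gs : gspan H = s by rewrite /gspan HT cardsT card_ord.
(* The dimension is generalized so that its equality with [s] can be substituted in the dependent
   type. *)
have gen n (f : 'I_n -> 'I_s) : n = s -> (forall i, f i = i :> nat) ->
    Tagged cubegraph
      ([set [ffun i => (x : cube s) (f i)] | x in vertices H],
       [set [set [ffun i => (x : cube s) (f i)] | x in (e : {set cube s})] | e in edges H]
        : {set {set cube n}}) = Tagged cubegraph H :> cube_subgraph.
  move=> ns; subst n => fE; rewrite [H in RHS]surjective_pairing.
  have pE (x : cube s) : [ffun i => x (f i)] = x.
    by apply/ffunP => i; rewrite ffunE; congr (x _); apply: val_inj; apply: fE.
  have vE (V : {set cube s}) : [set [ffun i => (x : cube s) (f i)] | x in V] = V.
    by rewrite (eq_imset _ pE) imset_id.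
  by rewrite vE (eq_imset _ vE) imset_id.
apply: (gen _ (support_inj (H := H)) gs) => i.
rewrite /support_inj (enum_val_nth (support_inj i)).
rewrite (eq_enum (B := 'I_s)) => [|j]; last by rewrite HT inE.
by rewrite nth_enum_ord // -[X in (_ < X)%N]gs.
Qed.

(** Every direction of the canonical copy is used by the projection of an edge, so its support is
    full. Being ambient-isomorphic to a canonical [K] thus means having canonical copy [K]. *)
Lemma canonical_copy_idem d (C : cubegraph d) :
  canonical_copy (tagged (canonical_copy C)) = canonical_copy C.
Proof.
rewrite canonical_copy_full; first by [].
apply/setP => i; rewrite !inE.
have : support_inj (H := C) i \in gsupport C by apply: enum_valP.
rewrite inE => /existsP[x /existsP[y /and3P[xy xi yi]]].
apply/existsP; exists (project C x); apply/existsP; exists (project C y).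
rewrite !ffunE xi yi !andbT; apply/imsetP; exists [set x; y] => //.
by rewrite imsetU !imset_set1.
Qed.

(** * Random subgraphs of the cube *)

Section RandomCubeSubgraph.
Variables (R : realFieldType) (p : R) (d : nat).
Hypothesis p01 : 0 <= p <= 1.
Implicit Types (E I J T U : {set {set cube d}}).

(* Non-edges of the cube are absent with weight 1, so sums may range over all edge sets. *)
Definition edge_weight (e : {set cube d}) (b : bool) : R :=
  if e \in cube_edges d then (if b then p else 1 - p) else (~~ b)%:R.

Definition Qp_weight E : R := \prod_e edge_weight e (e \in E).

Definition prob (P : pred {set {set cube d}}) : R := \sum_(E | P E) Qp_weight E.

Definition pattern_weight I T : R := \prod_(e in I) edge_weight e (e \in T).

Lemma Qp_weightE E : Qp_weight E =
  if E \subset cube_edges d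
  then \prod_(e in cube_edges d) (if e \in E then p else 1 - p) else 0.
Proof.
rewrite /Qp_weight; case: ifPn => [/subsetP EQ|/subsetPn[e eE eQ]].
  rewrite [RHS]big_mkcond; apply: eq_bigr => e _; rewrite /edge_weight.
  by case: ifPn => // eQ; rewrite (contraNF (EQ e) eQ).
by rewrite (bigD1 e) //= /edge_weight (negbTE eQ) eE mul0r.
Qed.

Lemma edge_weight_ge0 e b : 0 <= edge_weight e b.
Proof.
by case/andP: p01 => p0 p1; rewrite /edge_weight; case: ifP; case: b; rewrite ?ler0n ?subr_ge0.
Qed.

Lemma edge_weight_le1 e b : edge_weight e b <= 1.
Proof.
by case/andP: p01 => p0 p1; rewrite /edge_weight; case: ifP; case: b; rewrite ?lern1 ?gerBl.
Qed.

Lemma edge_weight_sum e : edge_weight e true + edge_weight e false = 1.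
Proof. by rewrite /edge_weight; case: ifP => _ /=; rewrite ?add0r // addrC subrK. Qed.

Lemma Qp_weight_ge0 E : 0 <= Qp_weight E.
Proof. by apply: prodr_ge0 => e _; apply: edge_weight_ge0. Qed.

Lemma pattern_weight_ge0 I T : 0 <= pattern_weight I T.
Proof. by apply: prodr_ge0 => e _; apply: edge_weight_ge0. Qed.

Lemma le_prob (P P' : pred {set {set cube d}}) :
  (forall E, P E -> P' E) -> prob P <= prob P'.
Proof.
move=> h; rewrite /prob [leRHS]big_mkcond [leLHS]big_mkcond; apply: ler_sum => E _.
by case: ifP => [/h ->//|_]; case: ifP => // _; apply: Qp_weight_ge0.
Qed.

(** The weights of all [E] with the same trace on [I] add up to a product over edges, in which each
    edge outside [I] contributes total weight 1. *)
Lemma sum_pattern_weight I (f : {set {set cube d}} -> R) :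
  \sum_E Qp_weight E * f (E :&: I) = \sum_(T : {set {set cube d}} | T \subset I) pattern_weight I T * f T.
Proof.
rewrite (partition_big (fun E => E :&: I) (fun T : {set {set cube d}} => T \subset I)) /=; last first.
  by move=> E _; apply: subsetIr.
apply: eq_bigr => T TI.
rewrite (eq_bigr (fun E => Qp_weight E * f T)) => [|E /eqP -> //].
rewrite -mulr_suml; congr (_ * _); rewrite /Qp_weight.
(* Inside [I] the status that disagrees with [T] gets weight 0, so the sum may range over all
   [E]. *)
pose F e b := if e \in I then (if b == (e \in T) then edge_weight e b else 0) else edge_weight e b.
transitivity (\prod_e (F e true + F e false)).
  rewrite bigA_distr big_mkcond /=; apply: eq_bigr => E _.
  case: ifPn => [/eqP ET|ne].
    apply: eq_bigr => e _; rewrite /F -ET inE.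
    by case: (e \in E); case: (e \in I).
  have [e ne'] : exists e, (e \in E :&: I) != (e \in T).
    apply/existsP; apply: contraR ne; rewrite negb_exists => /forallP h.
    by apply/eqP/setP => e; have := h e; rewrite negbK => /eqP.
  rewrite (bigD1 e) //= [X in X * _](_ : _ = 0) ?mul0r // /F.
  move: ne'; rewrite inE; case eI: (e \in I); rewrite ?andbT ?andbF.
    by case: (e \in E); case: (e \in T).
  by move: (subsetP TI e); rewrite eI; case: (e \in T) => // /(_ isT).
rewrite /pattern_weight [RHS]big_mkcond; apply: eq_bigr => e _; rewrite /F.
case: ifP => eI; last exact: edge_weight_sum.
by case: (e \in T); rewrite ?addr0 ?add0r.
Qed.

Lemma Qp_weight_split I E : Qp_weight E = pattern_weight I (E :&: I) * pattern_weight (~: I) (E :\: I).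
Proof.
rewrite /Qp_weight (bigID (mem I)) /=; congr (_ * _).
  by apply: eq_bigr => e eI; rewrite inE [e \in I]eI andbT.
by apply: eq_big => [e|e eI]; rewrite !inE // [e \in I](negbTE eI).
Qed.

(** [E] is the free union of its parts inside and outside [I], and its weight factors
    accordingly. *)
Lemma prob_indep I (f g : {set {set cube d}} -> R) :
  \sum_E Qp_weight E * (f (E :&: I) * g (E :\: I)) =
  (\sum_E Qp_weight E * f (E :&: I)) * \sum_E Qp_weight E * g (E :\: I).
Proof.
have -> : \sum_E Qp_weight E * g (E :\: I) =
   \sum_(U : {set {set cube d}} | U \subset ~: I) pattern_weight (~: I) U * g U.
  by rewrite -sum_pattern_weight; apply: eq_bigr => E _; rewrite setDE.
rewrite sum_pattern_weight big_distrlr /= pair_big_dep /=.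
rewrite (reindex_onto (fun q => q.1 :|: q.2) (fun E => (E :&: I, E :\: I))) /=; last first.
  by move=> E _; rewrite setID.
apply: eq_big => [[T U]|[T U]] /=.
  apply/eqP/andP => [[<- <-]|[TI UI]].
    by rewrite subsetIr setDE subsetIr.
  have UI0 : U :&: I = set0 by apply/eqP; rewrite setI_eq0 disjoints_subset.
  congr (_, _); first by rewrite setIUl UI0 setU0; apply/setIidPl.
  rewrite setDUl (_ : T :\: I = set0) ?set0U; last by apply/eqP; rewrite setD_eq0.
  by rewrite setDE; apply/setIidPl.
case/eqP=> eT eU; rewrite eT eU (Qp_weight_split I) eT eU; ring.
Qed.

Lemma prob_pattern I T : T \subset I -> prob (fun E => E :&: I == T) = pattern_weight I T.
Proof.
move=> TI; have := sum_pattern_weight I (fun U => (U == T)%:R).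
rewrite [RHS](bigD1 T) //= eqxx mulr1 [X in _ + X]big1 ?addr0.
  move=> <-; rewrite /prob big_mkcond; apply: eq_bigr => E _.
  by case: (_ == _); rewrite ?mulr1 ?mulr0.
by move=> U /andP[_ /negbTE ->]; rewrite mulr0.
Qed.

Lemma sum_Qp_weight : \sum_E Qp_weight E = 1.
Proof.
have := @prob_pattern set0 set0 (sub0set _); rewrite /pattern_weight big_set0 => <-.
by apply: eq_bigl => E; rewrite setI0 eqxx.
Qed.

Lemma pattern_weight_absent I T (D : {set {set cube d}}) : D \subset I -> D \subset cube_edges d -> [disjoint D & T] ->
  pattern_weight I T <= (1 - p) ^+ #|D|.
Proof.
move=> DI DQ DT; rewrite /pattern_weight (big_setID D) /= (setIidPr DI) -[leRHS]mulr1.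
apply: ler_pM; try by apply: prodr_ge0 => e _; apply: edge_weight_ge0.
  rewrite (eq_bigr (fun=> 1 - p)) ?prodr_const // => e eD.
  by rewrite /edge_weight (subsetP DQ _ eD) (disjointFr DT eD).
by apply: prodr_ile1 => e _; rewrite edge_weight_ge0 edge_weight_le1.
Qed.

(** Together the two events prescribe [T :|: (U :\: I)] on [I :|: J]. This is only an inequality
    because [T] and [U] may disagree on [I :&: J], and then the left side is 0. *)
Lemma prob_two_patterns I J T U : T \subset I -> U \subset J ->
  prob (fun E => (E :&: I == T) && (E :&: J == U)) <=
  pattern_weight I T * pattern_weight (J :\: I) (U :\: I).
Proof.
move=> TI UJ; have TU0 : (U :\: I) :&: I = set0.
  by apply/setP => e; rewrite !inE; case: (e \in I); rewrite ?andbF.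
have -> : pattern_weight I T * pattern_weight (J :\: I) (U :\: I) =
    pattern_weight (I :|: J) (T :|: (U :\: I)).
  rewrite /pattern_weight [in RHS](big_setID I) /= setUK setDUl setDv set0U.
  congr (_ * _); apply: eq_bigr => e; rewrite !inE.
    by move=> ->; rewrite orbF.
  by case/andP=> eI _; rewrite (contraNF (subsetP TI e) eI).
rewrite -prob_pattern; last first.
  by rewrite subUset (subset_trans TI) ?subsetUl // (subset_trans (subsetDl _ _)) // (subset_trans UJ) ?subsetUr.
apply: le_prob => E /andP[/eqP <- /eqP <-]; apply/eqP/setP => e; rewrite !inE.
by case: (e \in E); case: (e \in I); case: (e \in J).
Qed.

End RandomCubeSubgraph.

(** * Dependence among the copies of the H_j *)

Section CubeComponents.
Variables (R : rcfType) (p : R) (d r : nat) (hr : (0 < r)%N) (H : 'I_r -> cube_subgraph).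
Hypothesis p01 : 0 <= p < 1.
Hypothesis Hcan : forall j, is_canonical (H j).
Hypothesis Hinj : injective H.
Hypothesis d0 : (0 < d)%N.

Local Notation graph := ({set cube d} * {set {set cube d}})%type.
Implicit Types (E : {set {set cube d}}) (b c C : graph) (j k : 'I_r).
Local Notation w := (@Qp_weight R p d).
Local Notation inc b := (incident (vertices (b : cubegraph d))).

Let p01' : 0 <= p <= 1. Proof. by case/andP: p01 => -> /ltW. Qed.

Definition isoto C j := ambient_isomorphic (C : cubegraph d) (tagged (H j)).

Lemma isotoP C j : reflect (canonical_copy (C : cubegraph d) = H j) (isoto C j).
Proof.
have e : canonical_copy (tagged (H j)) = H j.
  by have [d' [G [_ <-]]] := Hcan j; apply: canonical_copy_idem.
by rewrite /isoto /ambient_isomorphic e; apply: eqP.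
Qed.

(** The default type goes to graphs isomorphic to no H_j; these never occur in [copies_in] and carry
    no weight. *)
Definition gtype C : 'I_r := odflt (Ordinal hr) [pick j | isoto C j].
Definition is_copy C := connected_subgraph (C : cubegraph d) && [exists j, isoto C j].
Definition copies_in E : {set graph} := [set C in components E | [exists j, isoto C j]].
(** [C] itself is added so that every pair is in its own neighbourhood, even one with no incident
    edge, such as a pair with empty vertex set. *)
Definition near_copies C : {set graph} :=
  [set C' : graph | (C' == C) || ~~ [disjoint inc C & inc C']].

Lemma gtypeE C j : isoto C j -> gtype C = j.
Proof.
move=> Cj; rewrite /gtype; case: pickP => [k Ck|/(_ j)]; last by rewrite Cj.
by apply: Hinj; rewrite -(isotoP _ _ Ck) -(isotoP _ _ Cj).
Qed.

Lemma is_copyP C : is_copy C ->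
  connected_subgraph (C : cubegraph d) /\ canonical_copy (C : cubegraph d) = H (gtype C).
Proof. by case/andP=> cC /existsP[j Cj]; split=> //; rewrite (gtypeE Cj); apply/isotoP. Qed.

Lemma mem_copies_in E C : E \subset cube_edges d ->
  (C \in copies_in E) = is_copy C && (E :&: inc C == edges (C : cubegraph d)).
Proof.
by move=> EQ; rewrite inE (mem_components (C : cubegraph d) EQ) /is_copy andbAC.
Qed.

Lemma Qp_weight_out E : ~~ (E \subset cube_edges d) -> w E = 0.
Proof. by move=> h; rewrite Qp_weightE (negbTE h). Qed.

Lemma eq_Qp_sum (P P' : pred {set {set cube d}}) :
  (forall E, E \subset cube_edges d -> P E = P' E) -> \sum_(E | P E) w E = \sum_(E | P' E) w E.
Proof.
move=> h; rewrite [LHS]big_mkcond [RHS]big_mkcond; apply: eq_bigr => E _.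
case: (boolP (E \subset cube_edges d)) => [/h -> //|/Qp_weight_out ->].
by case: ifP; case: ifP.
Qed.

Lemma edges_incident C : connected_subgraph (C : cubegraph d) -> edges (C : cubegraph d) \subset inc C.
Proof.
move=> /connected_subgraphP[hQ hV _ _]; apply/subsetP => e eC.
have eQ := subsetP hQ _ eC; apply/incidentP; split=> //.
have /cube_edgesP[x [y [exy _]]] := eQ; exists x; first by rewrite exy !inE eqxx.
by apply: (subsetP (hV _ eC)); rewrite exy !inE eqxx.
Qed.

Lemma marginal_copy C : is_copy C ->
  marginal w copies_in C = pattern_weight p (inc C) (edges (C : cubegraph d)).
Proof.
move=> hC; have [cC _] := is_copyP hC.
rewrite -prob_pattern ?edges_incident //; apply: eq_Qp_sum => E EQ.
by rewrite mem_copies_in // hC.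
Qed.

Lemma marginal_not_copy C : ~~ is_copy C -> marginal w copies_in C = 0.
Proof.
move=> /negbTE hC; rewrite /marginal (@eq_Qp_sum _ pred0) ?big_pred0 // => E EQ.
by rewrite mem_copies_in // hC.
Qed.

Lemma joint_not_copy b c : ~~ (is_copy b && is_copy c) -> joint w copies_in b c = 0.
Proof.
move=> /negbTE hC; rewrite /joint (@eq_Qp_sum _ pred0) ?big_pred0 // => E EQ.
rewrite !mem_copies_in //; move: hC; case: (is_copy b); case: (is_copy c) => //=.
by rewrite andbF.
Qed.

Lemma copies_indep b (U : {set graph}) :
  \sum_(E | (b \in copies_in E) && (copies_in E :\: near_copies b == U)) w E =
  marginal w copies_in b * \sum_(E | copies_in E :\: near_copies b == U) w E.
Proof.
case: (boolP (is_copy b)) => hb; last first.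
  rewrite marginal_not_copy // mul0r (@eq_Qp_sum _ pred0) ?big_pred0 // => E EQ.
  by rewrite mem_copies_in // (negbTE hb).
(* The copies outside the neighbourhood of [b] can be read off from the edges not incident to [b],
   whereas the presence of [b] depends only on the incident ones. *)
pose far F := [set c : graph | [&& is_copy c, c \notin near_copies b & F :&: inc c == edges (c : cubegraph d)]].
have farE E : E \subset cube_edges d -> copies_in E :\: near_copies b = far (E :\: inc b).
  move=> EQ; apply/setP => c; rewrite in_setD mem_copies_in // [RHS]inE.
  case: (boolP (c \in near_copies b)) => [|cb]; rewrite ?andbF ?andbT //=.
  suff -> : (E :\: inc b) :&: inc c = E :&: inc c by [].
  have := cb; rewrite inE negb_or negbK => /andP[_ dbc].
  apply/setP => e; rewrite !in_setI in_setD; case: (boolP (e \in inc c)) => ec; last by rewrite !andbF.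
  by rewrite (disjointFl dbc ec).
have -> : \sum_(E | (b \in copies_in E) && (copies_in E :\: near_copies b == U)) w E =
   \sum_E w E * ((E :&: inc b == edges (b : cubegraph d))%:R * (far (E :\: inc b) == U)%:R).
  rewrite (@eq_Qp_sum _ (fun E => (E :&: inc b == edges (b : cubegraph d)) && (far (E :\: inc b) == U))).
    rewrite big_mkcond; apply: eq_bigr => E _.
    by case: (_ == _); case: (_ == _); rewrite /= ?mulr1 ?mulr0 ?mul0r.
  by move=> E EQ; rewrite mem_copies_in // hb farE.
rewrite (prob_indep p (inc b) (fun T => (T == edges (b : cubegraph d))%:R) (fun F => (far F == U)%:R)).
congr (_ * _).
  rewrite /marginal (@eq_Qp_sum _ (fun E => E :&: inc b == edges (b : cubegraph d))).
    by rewrite [RHS]big_mkcond; apply: eq_bigr => E _; case: (_ == _); rewrite ?mulr1 ?mulr0.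
  by move=> E EQ; rewrite mem_copies_in // hb.
rewrite (@eq_Qp_sum _ (fun E => far (E :\: inc b) == U)).
  by rewrite [RHS]big_mkcond; apply: eq_bigr => E _; case: (_ == _); rewrite ?mulr1 ?mulr0.
by move=> E EQ; rewrite farE.
Qed.

Variables (v0 t : nat).
Hypothesis v0_max : forall j, (num_vertices (H j) <= v0)%N.
Hypothesis t_min : forall j, (t <= num_vertices (H j))%N.

Local Notation q := (1 - p).
Let q0 : 0 < q. Proof. by rewrite subr_gt0; case/andP: p01. Qed.
Let q1 : q <= 1. Proof. by rewrite gerBl; case/andP: p01. Qed.

Lemma card_copy C : is_copy C -> #|vertices (C : cubegraph d)| = num_vertices (H (gtype C)).
Proof. by move=> /is_copyP[cC <-]; rewrite num_vertices_canonical_copy. Qed.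

Lemma card_copy_le C : is_copy C -> (#|vertices (C : cubegraph d)| <= v0)%N.
Proof. by move=> /card_copy ->. Qed.

(* A copy with [n] vertices has at least [n * d - 2 * v0 ^ 2] edges which leave it and do not
   touch a given copy disjoint from it; all of them are absent when it is a component. *)
Definition copy_weight n : R := q ^+ (n * d) / q ^+ (2 * v0 ^ 2).

Lemma expr_le_copy_weight n m : (n * d <= m + 2 * v0 ^ 2)%N -> q ^+ m <= copy_weight n.
Proof.
move=> h; rewrite /copy_weight ler_pdivlMr ?exprn_gt0 // -exprD.
by apply: ler_wiXn2l => //; apply: ltW.
Qed.

Lemma boundary_edges C : connected_subgraph (C : cubegraph d) ->
  [disjoint boundary (vertices (C : cubegraph d)) & edges (C : cubegraph d)].
Proof.
move=> /connected_subgraphP[_ hV _ _]; apply/pred0P => e /=; rewrite inE.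
by apply/negbTE/negP => /andP[/andP[_ /negP h] /hV].
Qed.

Lemma boundary_incident C : boundary (vertices (C : cubegraph d)) \subset inc C.
Proof. by apply/subsetP => e; rewrite inE => /andP[]. Qed.

Lemma boundary_cube_edges C : boundary (vertices (C : cubegraph d)) \subset cube_edges d.
Proof. by apply/subsetP => e /(subsetP (boundary_incident C))/incidentP[]. Qed.

(** All boundary edges must be absent, and a copy with n vertices has at least nd - n^2 of them. *)
Lemma marginal_le C : is_copy C ->
  marginal w copies_in C <= copy_weight (num_vertices (H (gtype C))).
Proof.
move=> hC; have [cC _] := is_copyP hC; rewrite marginal_copy //.
apply: le_trans (pattern_weight_absent p01' (boundary_incident C) (boundary_cube_edges C)
  (boundary_edges cC)) _.
apply: expr_le_copy_weight; rewrite -card_copy //.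
apply: leq_trans (leq_card_boundary _) _; rewrite leq_add2l.
by apply: (@leq_trans (v0 ^ 2)); rewrite ?leq_pmull // leq_exp2r // card_copy_le.
Qed.

(** Distinct components are disjoint, so copies that share a vertex never occur together. Otherwise
    the pattern around [b] costs its marginal, and the boundary edges of [c] not incident to [b]
    must be absent besides; at most [v0 ^ 2] boundary edges of [c] touch [b]. *)
Lemma joint_le b c : c != b -> is_copy b -> is_copy c ->
  joint w copies_in b c <= marginal w copies_in b * copy_weight (num_vertices (H (gtype c))).
Proof.
move=> cb hb hc; have [conb _] := is_copyP hb; have [conc _] := is_copyP hc.
have copy_weight0 n : 0 <= copy_weight n by rewrite divr_ge0 ?exprn_ge0 ?ltW.
have marg0 : 0 <= marginal w copies_in b.
  by apply: marginal_ge0 => E; apply: Qp_weight_ge0.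
case: (boolP [disjoint vertices (c : cubegraph d) & vertices (b : cubegraph d)]) => dbc; last first.
  have -> : joint w copies_in b c = 0; last exact: mulr_ge0.
  rewrite /joint (@eq_Qp_sum _ pred0) ?big_pred0 // => E EQ.
  apply/negP => /andP[]; rewrite !inE => /andP[bE _] /andP[cE _].
  by move/negP: dbc; apply; apply: components_disjoint cE bE cb.
rewrite marginal_copy //.
apply: (@le_trans _ _ (prob p (fun E =>
   (E :&: inc b == edges (b : cubegraph d)) && (E :&: inc c == edges (c : cubegraph d))))).
  rewrite /joint (@eq_Qp_sum _ (fun E =>
   (E :&: inc b == edges (b : cubegraph d)) && (E :&: inc c == edges (c : cubegraph d)))) // => E EQ.
  by rewrite !mem_copies_in // hb hc.
apply: le_trans (prob_two_patterns p01' (edges_incident conb) (edges_incident conc)) _.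
apply: ler_wpM2l; first exact: pattern_weight_ge0.
set D := boundary (vertices (c : cubegraph d)) :\: inc b.
apply: (@le_trans _ _ (q ^+ #|D|)).
  apply: pattern_weight_absent => //.
  - by apply: setSD; apply: boundary_incident.
  - exact: subset_trans (subsetDl _ _) (boundary_cube_edges c).
  - apply: disjointWl (subsetDl _ _) _; apply: disjointWr (subsetDl _ _) _.
    exact: boundary_edges.
apply: expr_le_copy_weight; rewrite -card_copy //.
apply: leq_trans (leq_card_boundary _) _.
rewrite -(cardsID (inc b) (boundary _)) -/D [X in (X + _)%N]addnC -addnA leq_add2l mul2n -addnn.
apply: leq_add; last by rewrite leq_exp2r // card_copy_le.
apply: leq_trans (card_boundary_incident _) _; first by rewrite disjoint_sym.
by rewrite expnS expn1 leq_mul // card_copy_le.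
Qed.

Lemma near_weight_copy_le b c : is_copy b -> is_copy c ->
  near_weight w copies_in b c <=
  marginal w copies_in b * (2 * copy_weight (num_vertices (H (gtype c)))).
Proof.
move=> hb hc; have marg0 : 0 <= marginal w copies_in b.
  by apply: marginal_ge0 => E; apply: Qp_weight_ge0.
have -> : 2 * copy_weight (num_vertices (H (gtype c))) =
  copy_weight (num_vertices (H (gtype c))) + copy_weight (num_vertices (H (gtype c))) by ring.
rewrite mulrDr lerD //; first by rewrite ler_wpM2l // marginal_le.
case: ifP => cb; first exact: joint_le.
by rewrite mulr_ge0 // divr_ge0 ?exprn_ge0 ?ltW.
Qed.

Lemma near_weight_not_copy b c : ~~ (is_copy b && is_copy c) -> near_weight w copies_in b c = 0.
Proof.
move=> h; rewrite /near_weight joint_not_copy // if_same addr0.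
by move: h; rewrite negb_and => /orP[] /marginal_not_copy ->; rewrite ?mul0r ?mulr0.
Qed.

Hypothesis dq : d%:R * q ^+ d <= 1.

(** The 4 is 2 * 2, from the two terms of [near_weight] and from d + 1 <= 2d; [v0] bounds the
    vertices from which a nearby copy is reached; the power of [q] in the denominator comes from
    [copy_weight]. *)
Definition near_bound : R := 4 * v0%:R / q ^+ (2 * v0 ^ 2) * (d%:R * q ^+ d) ^+ t.

Lemma near_bound_ge0 : 0 <= near_bound.
Proof.
by rewrite /near_bound !mulr_ge0 ?invr_ge0 ?exprn_ge0 ?mulr_ge0 ?exprn_ge0 ?ler0n ?(ltW q0).
Qed.

Lemma near_copies_self b : is_copy b -> ~~ [disjoint inc b & inc b].
Proof.
move=> /is_copyP[/connected_subgraphP[_ _ [x xV] _] _].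
apply/pred0Pn; exists [set x; flip x (Ordinal d0)] => /=; rewrite andbb.
by apply/incidentP; split; [apply: flip_edge | exists x; rewrite ?inE ?eqxx].
Qed.

Lemma near_sum_copy_le b k : is_copy b ->
  \sum_(c in near_copies b | gtype c == k) near_weight w copies_in b c <=
  near_bound * marginal w copies_in b.
Proof.
move=> hb; have marg0 : 0 <= marginal w copies_in b.
  by apply: marginal_ge0 => E; apply: Qp_weight_ge0.
have copy_weight0 n : 0 <= copy_weight n by rewrite divr_ge0 ?exprn_ge0 ?ltW.
pose G := [set C : graph | [&& connected_subgraph (C : cubegraph d),
  canonical_copy (C : cubegraph d) == H k & ~~ [disjoint inc b & inc C]]].
apply: (@le_trans _ _ (\sum_(c in G) marginal w copies_in b * (2 * copy_weight (num_vertices (H k))))).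
  rewrite [leRHS]big_mkcond [leLHS]big_mkcond /=; apply: ler_sum => c _.
  have rhs0 : 0 <= marginal w copies_in b * (2 * copy_weight (num_vertices (H k))).
    by rewrite mulr_ge0 // mulr_ge0.
  case: ifP => [/andP[cN /eqP ck]|_]; last by case: ifP.
  case: (boolP (is_copy c)) => hc; last by rewrite near_weight_not_copy ?hb //; case: ifP.
  have [conc canc] := is_copyP hc.
  rewrite inE conc canc ck eqxx /=; move: cN; rewrite inE => /orP[/eqP cb|->].
    by rewrite cb near_copies_self // -ck -cb near_weight_copy_le.
  by rewrite -ck near_weight_copy_le.
(* With no copy nearby the sum is 0; otherwise one such copy shows that [H k] has span below its
   order. *)
case: (boolP (G == set0)) => [/eqP ->|/set0Pn[c0]].
  by rewrite big_set0 mulr_ge0 ?near_bound_ge0.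
rewrite inE => /and3P[conc /eqP canc _].
have sk : (tag (H k) < num_vertices (H k))%N.
  by rewrite -canc num_vertices_canonical_copy //; apply: span_lt_card.
rewrite sumr_const -[_ *+ #|G|]mulr_natl.
have cG : (#|G| <= v0 * 2 * d ^ num_vertices (H k))%N.
  apply: leq_trans (count_copies_near _ _) _.
  rewrite -mulnA -mulnA leq_mul ?card_copy_le //.
  apply: (@leq_trans (2 * d * d ^ tag (H k))).
    by rewrite leq_mul2r; apply/orP; right; rewrite mul2n -addnn -addn1 leq_add2l.
  by rewrite -mulnA leq_mul2l -expnS leq_pexp2l.
apply: (@le_trans _ _ ((v0 * 2 * d ^ num_vertices (H k))%:R *
   (marginal w copies_in b * (2 * copy_weight (num_vertices (H k)))))).
  by rewrite ler_wpM2r ?ler_nat // mulr_ge0 // mulr_ge0.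
have -> : (v0 * 2 * d ^ num_vertices (H k))%:R *
   (marginal w copies_in b * (2 * copy_weight (num_vertices (H k)))) =
   4 * v0%:R / q ^+ (2 * v0 ^ 2) * (d%:R * q ^+ d) ^+ num_vertices (H k) * marginal w copies_in b.
  rewrite /copy_weight !natrM natrX exprMn -exprM [(d * _)%N]mulnC.
  move: (_ ^-1) (q ^+ _) (d%:R ^+ _) (marginal _ _ _) (v0%:R) => Qi Qn dn a v; ring.
(* The exponent drops from the order of [H k] to [t] because [d%:R * q ^+ d <= 1]. *)
rewrite ler_wpM2r // ler_wpM2l //.
  by rewrite divr_ge0 ?mulr_ge0 ?exprn_ge0 ?ler0n ?(ltW q0).
by apply: ler_wiXn2l => //; rewrite mulr_ge0 ?exprn_ge0 ?ler0n ?(ltW q0).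
Qed.

Lemma near_sum_le_left j k :
  near_sum w copies_in gtype near_copies j k <= near_bound * type_mean w copies_in gtype j.
Proof.
rewrite /near_sum /type_mean mulr_sumr; apply: ler_sum => b _.
case: (boolP (is_copy b)) => hb; first exact: near_sum_copy_le.
rewrite marginal_not_copy // mulr0 big1 // => c _.
by rewrite near_weight_not_copy // (negbTE hb).
Qed.

Lemma near_sum_sym j k : near_sum w copies_in gtype near_copies j k =
  near_sum w copies_in gtype near_copies k j.
Proof.
rewrite /near_sum (exchange_big_dep (fun c => gtype c == k)) /=; last by move=> b c _ /andP[].
apply: eq_bigr => c ck; apply: eq_big => [b|b _].
  by rewrite ck andbT andbC; congr (_ && _); rewrite !inE eq_sym disjoint_sym.
rewrite /near_weight mulrC eq_sym; congr (_ + _); case: ifP => // _.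
by apply: eq_bigl => E; rewrite andbC.
Qed.

Lemma mem_copies_gtype E C j :
  (C \in copies_in E) && (gtype C == j) = (C \in components E) && isoto C j.
Proof.
rewrite in_set -andbA; congr (_ && _); apply/andP/idP => [[/existsP[k Ck] /eqP <-]|Cj].
  by rewrite (gtypeE Ck).
by rewrite (gtypeE Cj) eqxx; split=> //; apply/existsP; exists j.
Qed.

Lemma type_meanE j :
  type_mean w copies_in gtype j = \sum_E w E * (num_components (H j) E)%:R.
Proof.
rewrite /type_mean /marginal (exchange_big_dep predT) //=; apply: eq_bigr => E _.
rewrite sumr_const mulr_natr; congr (_ *+ _); apply: eq_card => C.
by rewrite in_set unfold_in /= andbC mem_copies_gtype.
Qed.

(** There are at most as many components as vertices; this is the bound with L = d. *)
Lemma type_mean_le j : type_mean w copies_in gtype j <= 2 ^+ d.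
Proof.
rewrite type_meanE; apply: (@le_trans _ _ (\sum_E w E * 2 ^+ d)); last first.
  by rewrite -mulr_suml sum_Qp_weight mul1r.
apply: ler_sum => E _; rewrite ler_wpM2l ?Qp_weight_ge0 // -natrX ler_nat.
apply: leq_trans (_ : (#|components E| <= _)%N).
  by apply/subset_leq_card/subsetP => C; rewrite inE => /andP[].
apply: leq_trans (leq_imset_card _ _) _.
by rewrite cardsT card_ffun card_bool card_ord.
Qed.

Variables (A : comAlgType R) (X : 'I_r -> A).

Lemma monomial_copies E :
  \prod_(C in copies_in E) X (gtype C) = monomial X (fun j => num_components (H j) E).
Proof.
rewrite (partition_big gtype predT) //=; apply: eq_bigr => j _.
rewrite (eq_bigr (fun=> X j)) => [|C /andP[_ /eqP ->] //].
rewrite prodr_const; congr (_ ^+ _); apply: eq_card => C.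
by rewrite in_set unfold_in /= mem_copies_gtype.
Qed.

(** The case L = d of the Stein-Chen bound. The means are at most 2^d, hence at most n, and their
    squares at most 4^d; the 8 absorbs d + 1 <= 2d. *)
Theorem components_binomial (phi : A -> R) n : scalar phi ->
  (forall e, `|phi (monomial X e)| <= 1) -> (2 ^ d <= n)%N ->
  `|\sum_E w E * phi (monomial X (fun j => num_components (H j) E))
    - phi (\prod_j bernoulli_gf X
        ((\sum_E w E * (num_components (H j) E)%:R) / (n + n)%:R) j ^+ (n + n))|
  <= 8 * r%:R ^+ 2 * d%:R * near_bound + (4 * r%:R * 4 ^+ d) / (n + n)%:R.
Proof.
move=> sphi phi1 hn.
have n0 : (0 < n)%N by apply: leq_trans hn; rewrite expn_gt0.
have w0 E : 0 <= w E by apply: Qp_weight_ge0.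
have N_refl b : b \in near_copies b by rewrite inE eqxx.
have near_le j k : near_sum w copies_in gtype near_copies j k <= near_bound * type_mean w copies_in gtype j
   /\ near_sum w copies_in gtype near_copies j k <= near_bound * type_mean w copies_in gtype k.
  by split; rewrite ?near_sum_le_left // near_sum_sym near_sum_le_left.
have lam_n j : type_mean w copies_in gtype j <= n%:R.
  by apply: le_trans (type_mean_le j) _; rewrite -natrX ler_nat.
have := stein_chen (X := X) w0 (sum_Qp_weight p d) N_refl copies_indep near_bound_ge0 near_le
  type_mean_le n0 lam_n sphi phi1.
rewrite scalar_sum //.
have -> : \sum_E phi (w E *: \prod_(C in copies_in E) X (gtype C)) =
    \sum_E w E * phi (monomial X (fun j => num_components (H j) E)).
  by apply: eq_bigr => E _; rewrite scalar_scale // monomial_copies.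
have -> : \prod_j bernoulli_gf X (type_mean w copies_in gtype j / (n + n)%:R) j ^+ (n + n) =
    \prod_j bernoulli_gf X
      ((\sum_E w E * (num_components (H j) E)%:R) / (n + n)%:R) j ^+ (n + n).
  by apply: eq_bigr => j _; rewrite type_meanE.
move=> h; apply: le_trans h _; apply: lerD.
  rewrite -subr_ge0 -[d.+1%:R]natr1.
  have -> : 8 * r%:R ^+ 2 * d%:R * near_bound - 4 * r%:R ^+ 2 * near_bound * (d%:R + 1) =
    4 * r%:R ^+ 2 * near_bound * (d%:R - 1) by ring.
  apply: mulr_ge0; last by rewrite subr_ge0 ler1n.
  by apply: mulr_ge0 near_bound_ge0; rewrite mulr_ge0 ?sqr_ge0.
rewrite -mulr_suml ler_wpM2r ?invr_ge0 ?ler0n //.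
apply: (@le_trans _ _ (\sum_(j < r) 4 * 4 ^+ d)).
  apply: ler_sum => j _; rewrite ler_wpM2l ?ler0n //.
  have -> : 4 ^+ d = (2 ^+ d) ^+ 2 :> R by rewrite exprAC; congr (_ ^+ d); ring.
  by rewrite lerXn2r ?nnegrE ?exprn_ge0 ?type_mean_ge0 ?type_mean_le.
by rewrite sumr_const card_ord -[_ *+ r]mulr_natr mulrAC.
Qed.

End CubeComponents.

(** * Passage to Poisson laws *)

Module MpolyForm.
  Import mpoly.

(** Polynomials in r variables realize the abstract algebra; extracting coefficients gives point
    probabilities. *)
Lemma ex_coefficient_form (R : rcfType) r :
  exists (A : comAlgType R) (X : 'I_r -> A) (coef : {ffun 'I_r -> nat} -> A -> R),
    (forall k, scalar (coef k)) /\
    forall k e, coef k (monomial X e) = (k == [ffun j => e j])%:R.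
Proof.
pose mon (k : {ffun 'I_r -> nat}) := mpoly.Multinom [tuple k i | i < r].
have monE k j : mpoly.fun_of_multinom (mon k) j = k j.
  exact: (mpoly.mnmE (fun i => k i) j).
exists (mpoly.mpoly r R : comAlgType R), (fun j => mpoly.mpolyX R (mpoly.mnm1 j)),
  (fun k P => mpoly.mcoeff (mon k) P); split.
  by move=> k a P Q; rewrite mpoly.mcoeffD mpoly.mcoeffZ.
move=> k e; have -> : monomial (fun j => mpoly.mpolyX R (mpoly.mnm1 j)) e =
    mpoly.mpolyX R (mon [ffun j => e j]).
  by rewrite mpoly.mpolyXE_id; apply: eq_bigr => j _; rewrite monE ffunE.
rewrite mpoly.mcoeffX eq_sym; congr (_%:R); congr nat_of_bool.
apply/eqP/eqP => [h|->//]; apply/ffunP => j; rewrite -[RHS]monE -[LHS]monE.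
by rewrite h.
Qed.

End MpolyForm.

Definition binomial_mass (R : fieldType) (a : R) n k : R :=
  'C(n, k)%:R * a ^+ k * (1 - a) ^+ (n - k).

Lemma bernoulli_gf_exp (R : rcfType) (A : comAlgType R) r (X : 'I_r -> A) a j n :
  bernoulli_gf X a j ^+ n = \sum_(i < n.+1) binomial_mass a n i *: X j ^+ i.
Proof.
rewrite bernoulli_gfE exprDn; apply: eq_bigr => i _.
rewrite !exprZn expr1n -scalerAl mul1r scalerA -scaler_nat scalerA /binomial_mass.
by congr (_ *: _); rewrite -mulrA [X in _ * X]mulrC.
Qed.

Lemma coef_bernoulli_gf_exp (R : rcfType) (A : comAlgType R) r (X : 'I_r -> A)
    (coef : A -> R) (k : {ffun 'I_r -> nat}) (a : 'I_r -> R) n : scalar coef ->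
  (forall e, coef (monomial X e) = (k == [ffun j => e j])%:R) ->
  coef (\prod_j bernoulli_gf X (a j) j ^+ n) = \prod_j binomial_mass (a j) n (k j).
Proof.
move=> sc coefE.
under eq_bigr do rewrite bernoulli_gf_exp.
rewrite bigA_distr_bigA /= scalar_sum //.
have term (f : {ffun 'I_r -> 'I_n.+1}) :
    coef (\prod_j (binomial_mass (a j) n (f j) *: X j ^+ f j)) =
    (\prod_j binomial_mass (a j) n (f j)) * (k == [ffun j => f j : nat])%:R.
  rewrite -coefE -scalar_scale //; congr coef; rewrite /monomial scaler_prod.
  by [].
rewrite (eq_bigr _ (fun f _ => term f)).
(* If all [k j] are at most [n], a single term of the expansion has exponent [k]. If not, no term
   has, and a binomial coefficient on the right is 0. *)
case: (boolP [forall j, (k j <= n)%N]) => [/forallP kn|].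
  pose g : {ffun 'I_r -> 'I_n.+1} := [ffun j => inord (k j)].
  have gE j : g j = k j :> nat by rewrite ffunE inordK // ltnS.
  rewrite (bigD1 g) //= [X in _ + X]big1 ?addr0.
    rewrite (_ : k == _) ?mulr1; last by apply/eqP/ffunP => j; rewrite ffunE gE.
    by apply: eq_bigr => j _; rewrite gE.
  move=> f fg; rewrite (_ : k == _ = false) ?mulr0 //.
  apply: contraNF fg => /eqP kf; apply/eqP/ffunP => j; apply: val_inj => /=.
  by rewrite gE kf ffunE.
rewrite negb_forall => /existsP[j kj]; rewrite -ltnNge in kj.
have z : binomial_mass (a j) n (k j) = 0 by rewrite /binomial_mass bin_small // !mul0r.
rewrite [RHS](bigD1 j) //= z mul0r big1 // => f _.
rewrite (_ : k == _ = false) ?mulr0 //; apply/eqP => /ffunP/(_ j); rewrite ffunE => e.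
by move: kj; rewrite e ltnNge -ltnS ltn_ord.
Qed.

From mathcomp Require Import all_classical all_reals all_analysis.

Import numFieldNormedType.Exports.

Local Open Scope classical_set_scope.
Local Open Scope ring_scope.

(** * Convergence of binomial masses to Poisson masses *)

Section PoissonLimit.
Variable R : realType.
Implicit Types (lam : R) (k n : nat).

(** At [lam = 0] this is the Dirac mass at 0, since [0 ^+ 0 = 1], in agreement with
    [poisson_prob]. *)
Definition poisson_mass lam k : R := lam ^+ k / k`!%:R * expR (- lam).

Lemma poisson_mass_ge0 lam k : 0 <= lam -> 0 <= poisson_mass lam k.
Proof. by move=> l0; rewrite /poisson_mass mulr_ge0 ?expR_ge0 // divr_ge0 ?exprn_ge0. Qed.

Lemma cvg_invn : (fun n => n%:R^-1 : R) @ \oo --> (0 : R).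
Proof.
apply: (@squeeze_cvgr _ _ _ _ (fun=> 0) (fun n => 2 * harmonic n)).
- near=> n; have n0 : (0 < n)%N by near: n; exists 1%N.
  rewrite invr_ge0 ler0n /= /harmonic /= ler_pdivlMr ?ltr0n //.
  rewrite ler_pdivrMl ?ltr0n // -natrM ler_nat.
  by rewrite muln2 -addnn -addn1 leq_add2l.
- exact: cvg_cst.
- rewrite -[X in _ --> X](mulr0 (2 : R)).
  by apply: cvgM; [apply: cvg_cst | apply: cvg_harmonic].
Unshelve. all: by end_near.
Qed.

Lemma cvg_double_inv lam : (fun n => lam / (n + n)%:R) @ \oo --> (0 : R).
Proof.
have -> : (fun n => lam / (n + n)%:R) = (fun n => lam / 2 * (n%:R^-1 : R)).
  by apply/funext => n; rewrite addnn -mul2n natrM invfM mulrA.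
rewrite -[X in _ --> X](mulr0 (lam / 2)).
by apply: cvgM; [apply: cvg_cst | apply: cvg_invn].
Qed.

Lemma cvg_one_sub lam : (fun n => 1 - lam / (n + n)%:R) @ \oo --> (1 : R).
Proof.
rewrite -[X in _ --> X](subr0 (1 : R)).
by apply: cvgB; [apply: cvg_cst | apply: cvg_double_inv].
Qed.

(** With x = lam/(2n), 1 - x lies between exp(-x/(1 - x)) and exp(-x). The lower bound is 1 + y <=
    exp(y) at y = x/(1 - x), where 1 + y = 1/(1 - x). *)
Lemma cvg_exp lam : 0 <= lam ->
  (fun n => (1 - lam / (n + n)%:R) ^+ (n + n)) @ \oo --> expR (- lam).
Proof.
move=> l0; set x := fun n => lam / (n + n)%:R.
have x0 n : 0 <= x n by rewrite /x divr_ge0.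
apply: (@squeeze_cvgr _ _ _ _ (fun n => expR (- lam / (1 - x n))) (fun=> expR (- lam))).
- near=> n.
  have n0 : (0 < n)%N by near: n; exists 1%N.
  have nn0 : (n + n)%:R != 0 :> R by rewrite pnatr_eq0 addn_eq0 andbb -lt0n.
  have x1 : 0 < 1 - x n.
    by near: n; apply: (cvgr_gt 1 (@cvg_one_sub lam)).
  have e : x n * (n + n)%:R = lam by rewrite /x divfK.
  apply/andP; split.
    have -> : - lam / (1 - x n) = (- (x n / (1 - x n))) * (n + n)%:R.
      by rewrite -e; ring.
    rewrite expRM_natr lerXn2r ?nnegrE ?expR_ge0 ?(ltW x1) //.
    rewrite expRN -[leRHS]invrK lef_pV2 ?posrE ?expR_gt0 ?invr_gt0 //.
    apply: le_trans (expR_ge1Dx _); rewrite le_eqVlt; apply/orP; left; apply/eqP.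
    rewrite -/(x n); move: (x n) x1 => y y1; field.
    by rewrite gt_eqF.
  rewrite -/(x n); have -> : - lam = - x n * (n + n)%:R by rewrite mulNr e.
  rewrite expRM_natr lerXn2r ?nnegrE ?expR_ge0 ?(ltW x1) //.
  exact: expR_ge1Dx.
- rewrite -[X in _ --> expR X]divr1.
  apply: (continuous_cvg _ (@continuous_expR R _)).
  by apply: cvgM; [apply: cvg_cst | apply: cvgV; [rewrite oner_eq0 | apply: cvg_one_sub]].
- exact: cvg_cst.
Unshelve. all: by end_near.
Qed.

Lemma cvg_ffact k : (fun n => ((n + n) ^_ k)%:R / (n + n)%:R ^+ k) @ \oo --> (1 : R).
Proof.
elim: k => [|k IHk].
  rewrite (_ : (fun n => _) = fun=> 1); first exact: cvg_cst.
  by apply/funext => n; rewrite ffactn0 expr0 divr1.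
have step : (fun n => ((n + n) ^_ k)%:R / (n + n)%:R ^+ k * (1 - k%:R / (n + n)%:R)) @ \oo --> (1 : R).
  by rewrite -[X in _ --> X](mulr1 (1 : R)); apply: cvgM => //; apply: cvg_one_sub.
apply: cvg_trans step; apply: near_eq_cvg; near=> n.
have nk : (k < n)%N by near: n; exists k.+1.
have nn0 : (n + n)%:R != 0 :> R by rewrite pnatr_eq0 addn_eq0 andbb; case: (n) nk.
rewrite ffactnSr natrM natrB; last by apply: leq_trans (leq_addr _ _); apply: ltnW.
rewrite exprSr; move: ((n + n)%:R : R) nn0 (((n + n) ^_ k)%:R : R) => N N0 F.
rewrite invfM -!mulrA; congr (_ * _).
by rewrite [RHS]mulrCA; congr (_ * _); rewrite mulrBl divff.
Unshelve. all: by end_near.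
Qed.

Lemma cvg_binomial_poisson lam k : 0 <= lam ->
  (fun n => binomial_mass (lam / (n + n)%:R) (n + n) k) @ \oo --> poisson_mass lam k.
Proof.
move=> l0.
have step : (fun n => lam ^+ k / k`!%:R * (((n + n) ^_ k)%:R / (n + n)%:R ^+ k *
   ((1 - lam / (n + n)%:R) ^+ (n + n) / (1 - lam / (n + n)%:R) ^+ k))) @ \oo --> poisson_mass lam k.
  rewrite /poisson_mass; apply: cvgM; first exact: cvg_cst.
  rewrite -[X in _ --> X]mul1r; apply: cvgM; first exact: cvg_ffact.
  rewrite -[X in _ --> X]divr1; apply: cvgM; first exact: cvg_exp.
  apply: cvgV; first by rewrite oner_eq0.
  rewrite -[X in _ --> X](expr1n R k).
  exact: (continuous_cvg _ (@exprn_continuous R k _) (@cvg_one_sub lam)).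
apply: cvg_trans step; apply: near_eq_cvg; near=> n.
have nk : (k < n)%N by near: n; exists k.+1.
have nn0 : (n + n)%:R != 0 :> R by rewrite pnatr_eq0 addn_eq0 andbb; case: (n) nk.
have x1 : 0 < 1 - lam / (n + n)%:R.
  by near: n; apply: (cvgr_gt 1 (@cvg_one_sub lam)).
have kn : (k <= n + n)%N by apply: leq_trans (leq_addr _ _); apply: ltnW.
rewrite /binomial_mass -[in LHS](subnK kn) exprD.
have k0 : k`!%:R != 0 :> R by rewrite pnatr_eq0 -lt0n fact_gt0.
rewrite -bin_ffact natrM expr_div_n subnK // mulfK ?expf_neq0 ?gt_eqF //.
by field; rewrite k0 expf_neq0.
Unshelve. all: by end_near.
Qed.

Lemma poisson_prob_nat lam k : 0 <= lam ->
  poisson_prob lam 0 (Posz @^-1` [set (k : int)]) = (poisson_mass lam k)%:E.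
Proof.
move=> l0; have -> : Posz @^-1` [set (k : int)] = [set k].
  by apply/seteqP; split=> n /= => [[]|->].
rewrite /poisson_prob; case: ifP => lp.
  rewrite esum_set1; last by rewrite lee_fin poisson_pmf_ge0.
  by rewrite /poisson_pmf lp.
have -> : lam = 0 by apply/eqP; rewrite eq_le l0 leNgt lp.
rewrite diracE /poisson_mass oppr0 expR0 mulr1 expr0n.
case: k => [|k] /=; first by rewrite mem_set // fact0 divr1.
by rewrite memNset ?mul0r.
Qed.

Lemma poisson_prob_neg lam k : poisson_prob lam 0 (Posz @^-1` [set Negz k]) = 0%E.
Proof.
rewrite (_ : _ @^-1` _ = set0); last by apply/seteqP; split.
by rewrite /poisson_prob esum_set0 diracE in_set0 if_same.
Qed.

End PoissonLimit.

(** * From finite sets of outcomes to total variation *)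

Section DiscreteBound.
Variables (R : realType) (p : R) (d r : nat) (hr : (0 < r)%N) (H : 'I_r -> cube_subgraph).
Hypothesis p01 : 0 <= p < 1.
Hypothesis Hcan : forall j, is_canonical (H j).
Hypothesis Hinj : injective H.
Hypothesis d0 : (0 < d)%N.
Variables (v0 t : nat).
Hypothesis v0_max : forall j, (num_vertices (H j) <= v0)%N.
Hypothesis t_min : forall j, (t <= num_vertices (H j))%N.
Hypothesis dq : d%:R * (1 - p) ^+ d <= 1.

Local Notation w := (@Qp_weight R p d).

Definition counts (E : {set {set cube d}}) : {ffun 'I_r -> nat} :=
  [ffun j => num_components (H j) E].

Definition mean_count j : R := \sum_E w E * (num_components (H j) E)%:R.

Lemma mean_count_ge0 j : 0 <= mean_count j.
Proof.
apply: sumr_ge0 => E _; rewrite mulr_ge0 ?ler0n // Qp_weight_ge0 //.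
by case/andP: p01 => -> /ltW.
Qed.

Definition tv_bound : R := 8 * r%:R ^+ 2 * d%:R * near_bound p d v0 t.

(** The test functional is the sum of the coefficients indexed by [F], which is the indicator of [F]
    on monomials. The number of trials then tends to infinity with d and [F] fixed, which removes
    the error term. *)
Lemma counts_poisson (F : seq {ffun 'I_r -> nat}) : uniq F ->
  `|\sum_E w E * (counts E \in F)%:R
    - \sum_(k <- F) \prod_j poisson_mass (mean_count j) (k j)| <= tv_bound.
Proof.
move=> uF; have [A [X [coef [sc coefE]]]] := MpolyForm.ex_coefficient_form R r.
pose phi P := \sum_(k <- F) coef k P.
have sphi : scalar phi.
  by move=> a P Q; rewrite /phi mulr_sumr -big_split; apply: eq_bigr => k _; apply: sc.
have phiE e : phi (monomial X e) = ([ffun j => e j] \in F)%:R.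
  rewrite /phi; under eq_bigr do rewrite coefE.
  case: (boolP (_ \in F)) => [eF|eF].
    rewrite (bigD1_seq [ffun j => e j]) //= eqxx big1 ?addr0 // => k ke.
    by rewrite (negbTE ke).
  rewrite big_seq big1 // => k kF; case: eqP => // ke.
  by rewrite -ke kF in eF.
have phi1 e : `|phi (monomial X e)| <= 1 by rewrite phiE normr_nat lern1 leq_b1.
pose T n := \sum_(k <- F) \prod_j binomial_mass (mean_count j / (n + n)%:R) (n + n) (k j).
pose S := \sum_E w E * (counts E \in F)%:R.
have bound n : (2 ^ d <= n)%N -> `|S - T n| <= tv_bound + (4 * r%:R * 4 ^+ d) / (n + n)%:R.
  move=> hn.
  have := components_binomial hr p01 Hcan Hinj d0 v0_max t_min dq sphi phi1 hn.
  congr (`|_ - _| <= _).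
    by apply: eq_bigr => E _; rewrite phiE.
  apply: eq_bigr => k _.
  by rewrite (@coef_bernoulli_gf_exp _ _ _ X (coef k) k _ _ (sc k)) // => e; apply: coefE.
have cT : T n @[n --> \oo] --> \sum_(k <- F) \prod_j poisson_mass (mean_count j) (k j).
  apply: cvg_big => [|k _]; first exact: add_continuous.
  apply: cvg_big => [|j _]; first exact: mul_continuous.
  exact/cvg_binomial_poisson/mean_count_ge0.
apply: (@ler_cvg_to _ \oo _ _ (fun n => `|S - T n|)
  (fun n => tv_bound + (4 * r%:R * 4 ^+ d) / (n + n)%:R)).
- by apply: cvg_norm; apply: cvgB => //; apply: cvg_cst.
- rewrite -[X in _ --> X](addr0 tv_bound); apply: cvgD; first exact: cvg_cst.
  exact: cvg_double_inv.
- by exists (2 ^ d)%N => // n /= hn; apply: bound.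
Qed.

Definition int_counts (E : {set {set cube d}}) : {ffun 'I_r -> int} :=
  [ffun j => (num_components (H j) E)%:Z].

Definition int_mass (z : {ffun 'I_r -> int}) : R :=
  \prod_j (if z j is Posz k then poisson_mass (mean_count j) k else 0).

Lemma int_mass_ge0 z : 0 <= int_mass z.
Proof.
apply: prodr_ge0 => j _; case: (z j) => // k.
exact/poisson_mass_ge0/mean_count_ge0.
Qed.

(** Outcomes with a negative coordinate are never attained and have mass 0, so [F] may be replaced
    by its part in the natural numbers. *)
Lemma int_counts_poisson (F : seq {ffun 'I_r -> int}) : uniq F ->
  `|\sum_E w E * (int_counts E \in F)%:R - \sum_(z <- F) int_mass z| <= tv_bound.
Proof.
move=> uF.
pose up (k : {ffun 'I_r -> nat}) : {ffun 'I_r -> int} := [ffun j => (k j)%:Z].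
pose down (z : {ffun 'I_r -> int}) : {ffun 'I_r -> nat} := [ffun j => `|z j|%N].
have upK : cancel up down by move=> k; apply/ffunP => j; rewrite !ffunE.
(* [down] takes absolute values and may merge elements of [F], hence [undup]; the filter keeps the
   [k] that come from nonnegative elements. *)
pose G := [seq k <- undup (map down F) | up k \in F].
have memG k : (k \in G) = (up k \in F).
  rewrite mem_filter mem_undup andb_idr // => kF; apply/mapP.
  by exists (up k) => //; apply/esym/upK.
have uG : uniq G by rewrite filter_uniq // undup_uniq.
have -> : \sum_(z <- F) int_mass z = \sum_(k <- G) \prod_j poisson_mass (mean_count j) (k j).
  rewrite (bigID (fun z => [forall j, 0 <= (z : {ffun 'I_r -> int}) j])) /= addrC big1 ?add0r.
    rewrite -big_filter (perm_big (map up G)) ?big_map.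
      by apply: eq_bigr => k _; apply: eq_bigr => j _; rewrite ffunE.
    apply: uniq_perm; rewrite ?filter_uniq ?(map_inj_uniq (can_inj upK)) // => z.
    rewrite mem_filter; apply/andP/mapP => [[/forallP z0 zF]|[k kG ->]].
      have uz : up (down z) = z by apply/ffunP => j; rewrite !ffunE gez0_abs.
      by exists (down z) => //; rewrite memG uz.
    by rewrite -memG; split=> //; apply/forallP => j; rewrite ffunE.
  move=> z; rewrite negb_forall => /existsP[j zj].
  by rewrite /int_mass (bigD1 j) //=; case: (z j) zj => // k _; rewrite mul0r.
have -> : \sum_E w E * (int_counts E \in F)%:R = \sum_E w E * (counts E \in G)%:R.
  apply: eq_bigr => E _; rewrite memG; congr (_ * (_ \in F)%:R).
  by apply/ffunP => j; rewrite !ffunE.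
exact: counts_poisson.
Qed.

Lemma mean_components_count j : mean_components p d (H j) = mean_count j.
Proof.
rewrite /mean_components /Qp_mean /mean_count big_mkcond /=; apply: eq_bigr => E _.
by rewrite powersetE Qp_weightE /Qp_pmf; case: ifP => // _; rewrite mul0r.
Qed.

Lemma joint_lawE A :
  joint_law p d H A = (\sum_E w E * (int_counts E \in A)%:R)%:E.
Proof.
rewrite /joint_law big_mkcond /=; congr (_%:E); apply: eq_bigr => E _.
rewrite powersetE Qp_weightE /Qp_pmf -/(int_counts E).
by case: (E \subset _); case: (int_counts E \in A); rewrite /= ?mulr1 ?mulr0.
Qed.

Lemma poisson_lawE A :
  poisson_law (fun j => mean_components p d (H j)) A = (\esum_(z in A) (int_mass z)%:E)%E.
Proof.
rewrite /poisson_law; apply: eq_esum => z _; rewrite /int_mass -prodEFin.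
apply: eq_bigr => j _; rewrite mean_components_count.
case: (z j) => k; first by rewrite poisson_prob_nat // mean_count_ge0.
by rewrite poisson_prob_neg.
Qed.

Lemma dTV_components :
  (dTV (joint_law p d H) (poisson_law (fun j => mean_components p d (H j))) <= tv_bound%:E)%E.
Proof.
apply: ge_ereal_sup => _ [A _ <-]; rewrite joint_lawE poisson_lawE.
set mu := \sum_E _; set nu := (\esum_(z in A) _)%E.
have w0 E : 0 <= w E by rewrite Qp_weight_ge0 //; case/andP: p01 => -> /ltW.
have le1 : (mu%:E <= nu + tv_bound%:E)%E.
  (* Only finitely many outcomes are attained, so those in [A] form a finite set that carries all of
     [mu]. *)
  pose F := undup [seq int_counts E | E <- enum {set {set cube d}} & int_counts E \in A].
  have memF E : (int_counts E \in F) = (int_counts E \in A).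
    rewrite mem_undup; apply/mapP/idP => [[E']|EA].
      by rewrite mem_filter => /andP[E'A _] ->.
    by exists E => //; rewrite mem_filter EA mem_enum.
  have FA z : z \in F -> A z.
    rewrite mem_undup => /mapP[E]; rewrite mem_filter => /andP[EA _] ->.
    by move: EA; rewrite inE.
  have := int_counts_poisson (undup_uniq _ : uniq F).
  have -> : \sum_E w E * (int_counts E \in F)%:R = mu.
    by apply: eq_bigr => E _; rewrite memF.
  rewrite ler_distl => /andP[_ h].
  apply: (@le_trans _ _ ((\sum_(z <- F) int_mass z)%:E + tv_bound%:E)%E).
    by rewrite -EFinD lee_fin.
  apply: leeD => //; apply: esum_ge; exists [set` F].
    by split; [apply: finite_seq | move=> z /= /FA].
  by rewrite -sumEFin (fsbig_seq _ _ (undup_uniq _ : uniq F)).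
have le2 : (nu <= mu%:E + tv_bound%:E)%E.
  (* The sum over [A] is the supremum of its finite partial sums, and each obeys the bound. *)
  apply: ge_ereal_sup => _ [X [/finite_seqP[s Xs] XA] <-].
  have XF : X = [set` undup s] by rewrite Xs; apply/seteqP; split=> z /=; rewrite mem_undup.
  rewrite XF -fsbig_seq ?undup_uniq // sumEFin -EFinD lee_fin.
  have := int_counts_poisson (undup_uniq s); rewrite ler_distl => /andP[h _].
  have : \sum_E w E * (int_counts E \in undup s)%:R <= mu.
    apply: ler_sum => E _; rewrite ler_wpM2l // ler_nat.
    case: (boolP (_ \in undup s)) => // Es; rewrite mem_set //; apply: XA.
    by rewrite XF.
  by move: h; set a := \sum_(z <- _) _; set b := \sum_E _; lra.
have nu0 : (0 <= nu)%E by apply: esum_ge0 => z _; rewrite lee_fin int_mass_ge0.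
have nufin : nu \is a fin_num.
  by rewrite ge0_fin_numE //; apply: le_lt_trans le2 _; rewrite -EFinD ltry.
move: le1 le2; rewrite -(fineK nufin) -!EFinD !lee_fin => le1 le2.
rewrite ler_distl.
by apply/andP; split; lra.
Qed.

End DiscreteBound.

(** (1 - p)^d is at most exp(-pd), and exp(pd) is at least (pd)^2 / 2, which exceeds or equals d as
    soon as d is at least 2 / p^2. *)
Lemma near_mul_expr_le1 (R : realType) (p : R) : 0 < p <= 1 ->
  \forall d \near \oo, d%:R * (1 - p) ^+ d <= 1.
Proof.
case/andP=> p0 p1; near=> d.
have d0 : (0 < d)%N by near: d; exists 1%N.
have dr0 : 0 < d%:R :> R by rewrite ltr0n.
have dp : 2 / p ^+ 2 <= d%:R by near: d; apply: nbhs_infty_ger.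
have le1 : (1 - p) ^+ d <= expR (- (p * d%:R)).
  rewrite -mulNr expRM_natr lerXn2r ?nnegrE ?expR_ge0 ?subr_ge0 //.
  exact: expR_ge1Dx.
have le2 : (p * d%:R) ^+ 2 / 2 <= expR (p * d%:R).
  have := @expR_ge1Dxn R (p * d%:R) 1; rewrite mulr_ge0 ?(ltW p0) // => /(_ isT).
  by rewrite (_ : (2`!) = 2)%N //; lra.
apply: le_trans (ler_wpM2l (ltW dr0) le1) _.
rewrite expRN ler_pdivrMr ?expR_gt0 // mul1r; apply: le_trans le2.
rewrite ler_pdivlMr // exprMn [d%:R ^+ 2]expr2 mulrA [leRHS]mulrC ler_wpM2l ?(ltW dr0) //.
by rewrite mulrC -ler_pdivrMr // exprn_gt0.
Unshelve. all: by end_near.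
Qed.

Theorem theorem6 (R : realType) (p : R) (hp0 : 0 < p) (hp1 : p < 1 / 2)
    (r : nat) (hr : (1 <= r)%N) (H : 'I_r -> cube_subgraph)
    (Hdistinct : injective H)
    (Hcanonical : forall j, is_canonical (H j))
    (Hsize : forall j, (num_vertices (H j))%:Z <= max_size p) :
  let q := 1 - p in
  let t := min_num_vertices hr H in
  exists C : R, \forall d \near \oo,
    (dTV (joint_law p d H) (poisson_law (fun j => mean_components p d (H j)))
       <= (C * (d%:R ^+ t.+1 * q ^+ (t * d)))%:E)%E.
Proof.
move=> q t.
have p01 : 0 <= p < 1 by apply/andP; split; lra.
have p01' : 0 < p <= 1 by apply/andP; split; lra.
pose v0 := \max_j num_vertices (H j).
have v0_max j : (num_vertices (H j) <= v0)%N by apply: leq_bigmax.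
have t_min j : (t <= num_vertices (H j))%N.
  rewrite /t /min_num_vertices; case: arg_minnP => // i _; exact.
(* The part of [tv_bound] free of d; what remains is d times (d q^d)^t. *)
exists (8 * r%:R ^+ 2 * (4 * v0%:R / q ^+ (2 * v0 ^ 2))); near=> d.
have d0 : (0 < d)%N by near: d; exists 1%N.
have dq : d%:R * (1 - p) ^+ d <= 1 by near: d; apply: near_mul_expr_le1.
apply: le_trans (dTV_components hr p01 Hcanonical Hdistinct d0 v0_max t_min dq) _.
rewrite lee_fin /tv_bound /near_bound -/q exprMn -exprM [(d * t)%N]mulnC [d%:R ^+ t.+1]exprS.
rewrite le_eqVlt; apply/orP; left; apply/eqP.
by move: (4 * _ / _) (d%:R ^+ t) (q ^+ (t * d)) => a b c; ring.
Unshelve. all: by end_near.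
Qed.
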